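(* For all integers $k \geq 1$ and $d \geq 2$, $$\beta_d(k) = \frac{1}{k} + \frac{1}{\pi}\sin\frac{\pi}{k}.$$
   Context: A closed curve $C$ in $\mathbb{R}^d$ is a rectifiable closed curve of positive finite length, denoted $w(C)$. It is identified with its arc-length parameterization $r\colon \mathbb{R}/w(C)\mathbb{Z} \to \mathbb{R}^d$; subsets and partitions of $C$ mean subsets and partitions of the parameter circle $\mathbb{R}/w(C)\mathbb{Z}$ (for a simple closed curve this is the same as subsets and partitions of the point set of $C$). For a non-empty subset $S$ of $C$, $w(S)$ denotes the minimum length of a closed curve in $\mathbb{R}^d$ (a single point being allowed, with length $0$) whose image contains $S$, that is, contains $r(S)$. $\hat P_k(C)$ denotes the set of all partitions of $C$ into $k$ non-empty (not necessarily connected) measurable sets of equal length, i.e. each part has Lebesgue measure $w(C)/k$. For $\mathcal{S} \in \hat P_k(C)$ define $$\beta(\mathcal{S}) = \frac{\frac{1}{k}\sum_{S\in\mathcal{S}} w(S)}{w(C)}, \qquad \beta(C,k) = \inf_{\mathcal{S}\in \hat P_k(C)} \beta(\mathcal{S}), \qquad \beta_d(k) = \sup_{C \text{ in } \mathbb{R}^d} \beta(C,k),$$ where the supremum is over all closed curves $C$ in $\mathbb{R}^d$. *)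

(* Defs.v *)
From HB Require Import structures.
From mathcomp Require Import all_boot all_order all_algebra.
From mathcomp Require Import all_classical all_reals all_analysis.

Set Implicit Arguments.
Unset Strict Implicit.
Unset Printing Implicit Defensive.

Import Order.TTheory GRing.Theory Num.Theory.
Import numFieldNormedType.Exports.

Local Open Scope classical_set_scope.
Local Open Scope ring_scope.

(* The library's norm on 'rV[R]_d is the sup norm; it induces the same topology
   as the Euclidean one but not the same lengths. *)
Definition enorm (R : realType) (d : nat) (v : 'rV[R]_d) : R :=
  Num.sqrt (\sum_(i < d) v 0 i ^+ 2).

Definition polygon_length (R : realType) (d : nat) (g : R -> 'rV[R]_d)
    (a : R) (s : seq R) : R :=
  \sum_(x <- zip s (a :: s)) enorm (g x.1 - g x.2).

Definition curve_length (R : realType) (d : nat) (g : R -> 'rV[R]_d)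
    (a b : R) : \bar R :=
  ereal_sup [set (polygon_length g a s)%:E | s in itv_partition a b].

(* A rectifiable closed curve of positive length [clen], given by its
   arc-length parameterization: maps out of the circle R/(clen)Z are
   clen-periodic maps out of R. *)
Record closed_curve (R : realType) (d : nat) := ClosedCurve {
  clen : R;
  cparam :> R -> 'rV[R]_d;
  clen_gt0 : 0 < clen;
  cparam_periodic : forall t, cparam (t + clen) = cparam t;
  cparam_arc_length : forall a b, a <= b ->
    curve_length cparam a b = (b - a)%:E }.

(* Closed curves in an arbitrary parameterization over [0, 1]; constant curves,
   i.e. single points, are included. *)
Definition closed_path (R : realType) (d : nat) (g : R -> 'rV[R]_d) : Prop :=
  {within `[0, 1], continuous g} /\ g 0 = g 1.

(* The minimal length of a closed curve through the points of S, written as an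
   infimum in \bar R. Nonrectifiable paths have length +oo and do not affect
   it, since C itself competes. *)
Definition w_subset (R : realType) (d : nat) (C : closed_curve R d)
    (S : set R) : \bar R :=
  ereal_inf [set curve_length g 0 1 | g in
    [set g : R -> 'rV[R]_d | closed_path g /\ C @` S `<=` g @` `[0, 1]]].

(* The circle R/(clen C)Z is represented by its fundamental domain [0, clen C[;
   Caratheodory measurability for the outer measure generated by interval
   length is Lebesgue (rather than Borel) measurability.
   The parts are numbered by 'I_k; being nonempty and disjoint, they are
   distinct, and nothing below depends on the numbering. *)
Definition equal_partition (R : realType) (d : nat) (C : closed_curve R d)
    (k : nat) (S : 'I_k -> set R) : Prop :=
  [/\ \bigcup_i S i = `[0, clen C[%classic,
      trivIset setT S,
      forall i, S i !=set0,
      forall i, (@wlength R idfun)^*%mu.-cara.-measurable (S i) &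
      forall i, completed_lebesgue_measure (S i) = (clen C / k%:R)%:E].

Local Open Scope ereal_scope.

Definition beta_partition (R : realType) (d : nat) (C : closed_curve R d)
    (k : nat) (S : 'I_k -> set R) : \bar R :=
  (k%:R^-1)%:E * (\sum_(i < k) w_subset C (S i)) * ((clen C)^-1)%:E.

Definition beta_curve (R : realType) (d : nat) (C : closed_curve R d)
    (k : nat) : \bar R :=
  ereal_inf [set beta_partition C S | S in @equal_partition R d C k].

Definition beta (R : realType) (d k : nat) : \bar R :=
  ereal_sup [set beta_curve C k | C in [set: closed_curve R d]].

(* Main.v *)
Require Import Defs.
From mathcomp Require Import all_boot all_order all_algebra.
From mathcomp Require Import all_classical all_reals all_analysis.
From mathcomp Require Import ring lra zify.

(** The value is attained by circles, and two independent arguments show that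
it is an upper and a lower bound.

Upper bound.  Cut a curve [C] of length [L] into [k] arcs of length [L / k].
An arc is covered by the closed curve that runs along it and returns along its
chord, so what has to be bounded is the mean chord length, for a good choice of
the cutting points.  Take [N = k * m] equally spaced points [p_i] of [C].  A
chord joins [p_i] to [p_(i+m)], while consecutive points are at distance at
most [L / N].  The discrete Fourier transform on Z/N diagonalizes both
[p |-> (p_(i+m) - p_i)_i] and [p |-> (p_(i+1) - p_i)_i]; their moduli at
frequency [j] are [2 |sin (j m x)|] and [2 |sin (j x)|] with [x = pi / N], and
[|sin (j m x)| / |sin (j x)|] is largest at [j = 1] ([norm_sin_mul_le]).
Parseval then bounds the quadratic mean of the chords ([sum_sqr_chord_le]), and
the Cauchy-Schwarz inequality their sum ([sum_chord_le]).  Averaging over the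
[m] possible offsets of the cutting points yields a partition of ratio at most
[1 / k + sin (pi / k) / (N sin (pi / N))], which tends to the claimed value as
[m] grows.

Lower bound.  For the unit circle, every part [S] has measure [2 pi / k], and
every closed curve through [S] is at least as long as an arc of that measure
together with its chord, i.e. [2 pi / k + 2 sin (pi / k)].  The proof is a
discrete form of the Cauchy-Crofton formula.  The projection of a closed curve
to a line of direction [u] has variation at least twice its range, and the
average of [|<v, u>|] over equally spaced directions of a plane is at most a
constant times the length of [v]; hence the length of the curve is bounded
below by a multiple of the mean of the support function
[u |-> max_(y in S) <y, u>] of [S] ([curve_length_shadow_ge]).  At a point [u]
of the circle, this function is the cosine of the distance of [u] to [S].  The
set of points at distance at most [r] of [S] has measure at least
[min (2 pi) (|S| + 2 r)], with equality for arcs ([card_cyclic_neighborhood]),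
so that a layer-cake summation ([layer_cake_sum_ge]) compares [S] to an arc.
The circle is divided into [2 k n] cells for this, and [n] tends to infinity
at the end. *)

Import Order.TTheory GRing.Theory Num.Theory.
Import numFieldNormedType.Exports.

Set Implicit Arguments.
Unset Strict Implicit.
Unset Printing Implicit Defensive.

Local Open Scope classical_set_scope.
Local Open Scope ring_scope.

(** * Trigonometric inequalities and sums *)

Section Trigonometry.
Variable R : realType.
Implicit Types x y t : R.

Lemma sin_mean_value x : 0 <= x ->
  exists2 c, 0 <= c <= x & sin x = cos c * x.
Proof.
move=> x0.
have [|c] := MVT_segment x0 (fun y _ => @is_derive_sin R y).
  by apply: continuous_subspaceT => y; exact: continuous_sin.
by rewrite in_itv/= sin0 !subr0 => cx e; exists c.
Qed.

Lemma sin_le_id x : 0 <= x -> sin x <= x.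
Proof.
move=> x0; have [c _ ->] := sin_mean_value x0.
by rewrite ler_piMl// cos_le1.
Qed.

(** The half-angle formula in the form that computes chords of the unit
circle. *)
Lemma sin_half_sqr x : 2 * sin (x / 2) ^+ 2 = 1 - cos x.
Proof.
rewrite {2}(_ : x = (x / 2) *+ 2); last by rewrite mulr2n; lra.
by rewrite cos_mulr2n cos2sin2 mulr2n; ring.
Qed.

Lemma norm_sin_le x : `|sin x| <= `|x|.
Proof.
wlog x0 : x / 0 <= x.
  move=> H; have [/H//|/ltW x0] := leP 0 x.
  by rewrite -normrN -sinN -(normrN x) H// oppr_ge0.
have [xpi|pix] := leP x pi.
  by rewrite !ger0_norm ?sin_le_id// sin_ge0_pi// x0.
rewrite (le_trans (sin_max _))// ger0_norm//.
by have := pi_ge2 R; lra.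
Qed.

Lemma sin_ge_cubic x : 0 <= x -> x - x ^+ 3 / 2 <= sin x.
Proof.
move=> x0; have [c /andP[c0 cx] ->] := sin_mean_value x0.
suff : 1 - x ^+ 2 / 2 <= cos c by move=> /(ler_wpM2r x0); lra.
have := sin_half_sqr c => e.
have : sin (c / 2) ^+ 2 <= (c / 2) ^+ 2.
  by rewrite -real_normK ?num_real// -[leRHS]real_normK ?num_real//
    lerXn2r ?nnegrE// norm_sin_le.
have : c ^+ 2 <= x ^+ 2 by rewrite lerXn2r ?nnegrE.
by lra.
Qed.

(** The discrete bounds below all converge thanks to this limit, which is squeezed
between the linear and the cubic bounds on the sine. *)
Lemma cvg_mul_sin_div c : 0 <= c ->
  (fun n : nat => n.+1%:R * sin (c / n.+1%:R)) @ \oo --> (c : R).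
Proof.
move=> c0.
apply: (@squeeze_cvgr _ _ _ _ (fun n => c - c ^+ 3 / 2 * n.+1%:R^-1) (cst c)).
- apply: nearW => n /=.
  have n0 : (0 : R) < n.+1%:R by rewrite ltr0n.
  have cn0 : 0 <= c / n.+1%:R by rewrite divr_ge0// ltW.
  apply/andP; split; last first.
    have := ler_wpM2l (ltW n0) (sin_le_id cn0).
    by rewrite [_ * (c / _)]mulrC divfK// gt_eqF.
  have := sin_ge_cubic cn0; move/(ler_wpM2l (ltW n0)).
  apply: le_trans.
  have n1 : (1 : R) <= n.+1%:R by rewrite ler1n.
  have -> : n.+1%:R * (c / n.+1%:R - (c / n.+1%:R) ^+ 3 / 2) =
     c - c ^+ 3 / 2 * n.+1%:R^-1 * n.+1%:R^-1 by field; rewrite gt_eqF.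
  rewrite lerD2l lerN2 ler_piMr//.
    by rewrite mulr_ge0 ?invr_ge0 ?divr_ge0 ?exprn_ge0// ltW.
  by rewrite invf_le1.
- rewrite -[X in _ --> X]subr0 -[X in _ - X](mulr0 (c ^+ 3 / 2)).
  apply: cvgB; first exact: cvg_cst.
  apply: cvgM; first exact: cvg_cst.
  exact: (@cvg_harmonic R).
- exact: cvg_cst.
Qed.

Lemma cvg_div_nat c : (fun n : nat => c / n.+1%:R : R) @ \oo --> (0 : R).
Proof.
rewrite -(mulr0 c); apply: cvgM; first exact: cvg_cst.
exact: (@cvg_harmonic R).
Qed.

Lemma sinD2pin x (n : nat) : sin (x + pi * 2 * n%:R) = sin x.
Proof.
have -> : pi * 2 * n%:R = pi *+ 2 *+ n :> R by rewrite mulr_natr mulr_natr.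
exact: (periodicn (@sinD2pi R)).
Qed.

Lemma cosD2pin x (n : nat) : cos (x + pi * 2 * n%:R) = cos x.
Proof.
have -> : pi * 2 * n%:R = pi *+ 2 *+ n :> R by rewrite mulr_natr mulr_natr.
exact: (periodicn (@cosD2pi R)).
Qed.

Lemma norm_sinDpin x (n : nat) : `|sin (x + pi * n%:R)| = `|sin x|.
Proof.
elim: n => [|n <-]; first by rewrite mulr0 addr0.
by rewrite -natr1 mulrDr mulr1 addrA sinDpi normrN.
Qed.

(** The Dirichlet kernel: multiplied by [2 * sin (h / 2)], each cosine becomes
a difference of sines at half-integer steps, and the sum telescopes. *)
Lemma sum_cos_arith t h (N : nat) :
  2 * sin (h / 2) * (\sum_(i < N) cos (t + i%:R * h)) =
  sin (t + N%:R * h - h / 2) - sin (t - h / 2).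
Proof.
elim: N => [|N IH]; first by rewrite big_ord0 mul0r addr0 subrr mulr0.
rewrite big_ord_recr /= mulrDr IH.
have -> : t + N.+1%:R * h - h / 2 = (t + N%:R * h) + h / 2.
  by rewrite -natr1; lra.
by rewrite sinB [sin (_ + h / 2)]sinD; ring.
Qed.

Lemma cos_le_anti x y : 0 <= x -> x <= y -> y <= pi -> cos y <= cos x.
Proof.
move=> x0 xy yp; have [xp y0] := (le_trans xy yp, le_trans x0 xy).
by rewrite leNgt ltr_cos ?in_itv/= -?leNgt ?x0 ?y0.
Qed.

Lemma sin_le_mono x y : 0 <= x -> x <= y -> y <= pi / 2 -> sin x <= sin y.
Proof.
move=> x0 xy yp; rewrite leNgt ltr_sin ?in_itv/= -?leNgt//;
by have := pi_gt0 R; lra.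
Qed.

(** The quotient [sin (m t) / sin t] decreases as long as [m t] stays in the
first quadrant: by the addition formula it is [cos t] times the quotient for
[m - 1], plus [cos ((m - 1) t)], and all of these are nonnegative and
decreasing. It is stated without division. *)
Lemma sin_mul_ratio (m : nat) x t : 0 < x -> x <= t -> m%:R * t <= pi / 2 ->
  sin (m%:R * t) * sin x <= sin (m%:R * x) * sin t.
Proof.
move=> x0 xt; have p0 := pi_gt0 R; elim: m => [|m IH] mt.
  by rewrite !mul0r sin0 !mul0r.
have m0 : (0:R) <= m%:R by [].
rewrite -natr1 in mt *.
have mt0 : 0 <= m%:R * t by rewrite mulr_ge0//; lra.
have mtp : m%:R * t <= pi / 2 by lra.
have tp : t <= pi / 2 by lra.
have mxt : m%:R * x <= m%:R * t by rewrite ler_wpM2l.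
have mx0 : 0 <= m%:R * x by rewrite mulr_ge0// ltW.
have {}IH := IH mtp.
rewrite !mulrDl !mul1r !sinD !mulrDl.
have sx : 0 <= sin x by apply: sin_ge0_pi; lra.
have st : 0 <= sin t by apply: sin_ge0_pi; lra.
have smx : 0 <= sin (m%:R * x) by apply: sin_ge0_pi; lra.
have ct : 0 <= cos t by apply: cos_ge0_pihalf; lra.
have cxt : cos t <= cos x by apply: cos_le_anti; lra.
have cmxt : cos (m%:R * t) <= cos (m%:R * x) by apply: cos_le_anti; lra.
apply: lerD.
  rewrite mulrAC; apply: (le_trans (ler_wpM2r ct IH)).
  by rewrite mulrAC ler_wpM2r// ler_wpM2l.
rewrite -!mulrA [sin t * _]mulrC ler_wpM2r// mulr_ge0//.
Qed.

(** Among the nonzero frequencies [j], the first one stretches a step of [1]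
into a step of [m] the most. With [t = j x], one may assume that [t] lies
between [x] and [pi / 2]. Below [pi / (2 m)] the quotient
[sin (m t) / sin t] is monotone; beyond, [|sin (m t)|] is at most [1], the
value at [pi / (2 m)], while [sin t] only grows. For [k = 1] both sides vanish. *)
Lemma norm_sin_mul_le (m k j : nat) (x := pi / (k * m)%:R : R) :
  (0 < m)%N -> (0 < k)%N -> (j <= k * m)%N ->
  `|sin (m%:R * (j%:R * x))| * sin x <= sin (m%:R * x) * `|sin (j%:R * x)|.
Proof.
move=> m0 k0 jN; have p0 := pi_gt0 R.
have mR : (0:R) < m%:R by rewrite ltr0n.
have kR : (0:R) < k%:R by rewrite ltr0n.
have NR : (0:R) < (k * m)%:R by rewrite ltr0n muln_gt0 k0.
have Nx : (k * m)%:R * x = pi by rewrite /x mulrC divfK// gt_eqF.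
have kmx : k%:R * (m%:R * x) = pi by rewrite mulrA -natrM.
have [->|j0] := posnP j; first by rewrite mul0r mulr0 sin0 normr0 mulr0 mul0r.
have [k1|k1] := leqP k 1.
  have {}k1 : k = 1%N by apply/eqP; rewrite eqn_leq k1.
  move: kmx; rewrite k1 mul1r => mx.
  rewrite (_ : m%:R * (j%:R * x) = 0 + pi * j%:R); last by rewrite -mx; ring.
  by rewrite norm_sinDpin mx sin0 sinpi normr0 !mul0r.
have k2 : (2:R) <= k%:R by rewrite ler_nat.
have x0 : 0 < x by rewrite divr_gt0.
have mx2 : m%:R * x <= pi / 2.
  rewrite ler_pdivlMr// mulrC -kmx ler_wpM2r// mulr_ge0// ltW//.
have j1 : (1:R) <= j%:R by rewrite ler1n.
set t := j%:R * x; have tE : t = j%:R * x by [].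
have xt : x <= t by rewrite ler_peMl// ltW.
clearbody t.
have tpi : t <= pi by rewrite tE -Nx ler_wpM2r ?ler_nat// ltW.
have m1 : (1:R) <= m%:R by rewrite ler1n.
have xmx : x <= m%:R * x by rewrite ler_peMl// ltW.
have sx : 0 <= sin x by apply: sin_ge0_pi; lra.
have smx : 0 <= sin (m%:R * x) by apply: sin_ge0_pi; lra.
have {tE} : t <= pi - x \/ t = pi.
  rewrite tE -Nx; move: jN; rewrite leq_eqVlt => /orP[/eqP->|jN]; first by right.
  left; rewrite -[X in _ - X]mul1r -mulrBl ler_wpM2r//; first exact: ltW.
  by rewrite lerBrDr natr1 ler_nat.
case=> [tpx|->]; last first.
  by rewrite [_ * pi]mulrC -[pi * _]add0r norm_sinDpin sin0 sinpi normr0 mul0r mulr0.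
(* The inequality is invariant under [t |-> pi - t]. *)
wlog t2 : t xt tpi tpx / t <= pi / 2.
  move=> H; have [/H|tp2] := leP t (pi / 2); first exact.
  have e : `|sin t| = `|sin (pi - t)|.
    by rewrite sinB sinpi cospi mul0r sub0r mulN1r opprK.
  have e' : `|sin (m%:R * t)| = `|sin (m%:R * (pi - t))|.
    rewrite -[LHS]normrN -sinN -[LHS](norm_sinDpin _ m).
    by congr `|sin _|; ring.
  by rewrite e e' H//; lra.
have st : 0 <= sin t by apply: sin_ge0_pi; lra.
rewrite (ger0_norm st).
have [mt|mt] := leP (m%:R * t) (pi / 2).
  rewrite ger0_norm ?sin_mul_ratio//; apply: sin_ge0_pi.
  by rewrite mulr_ge0//=; lra.
(* [y] is where [m * t] leaves the first quadrant. *)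
pose y := pi / 2 / m%:R : R.
have my : m%:R * y = pi / 2 by rewrite /y mulrC divfK// gt_eqF.
have xy : x <= y by rewrite -(ler_pM2l mR) my.
have yt : y <= t by rewrite -(ler_pM2l mR) my ltW.
apply: (@le_trans _ _ (sin (pi / 2) * sin x)).
  by rewrite ler_wpM2r// sin_pihalf sin_max.
have := @sin_mul_ratio m _ _ x0 xy; rewrite my => /(_ (lexx _)) /le_trans; apply.
by rewrite ler_wpM2l// sin_le_mono//; lra.
Qed.

End Trigonometry.

(** * Discrete Fourier transform of a periodic sequence *)

Section DiscreteFourier.
Variables (R : realType) (N : nat).
Hypothesis N0 : (0 < N)%N.
Implicit Types p : nat -> R.

Lemma sum_periodic_shift p s : (forall i, p (i + N)%N = p i) ->
  \sum_(i < N) p (i + s)%N = \sum_(i < N) p i.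
Proof.
move=> pN; elim: s => [|s <-]; first by apply: eq_bigr => i _; rewrite addn0.
have E : \sum_(i < N.+1) p (i + s)%N = \sum_(i < N.+1) p (i + s)%N by [].
move: E; rewrite {1}big_ord_recl big_ord_recr /= add0n [(N + s)%N]addnC pN.
rewrite [RHS]addrC => /addrI <-.
by apply: eq_bigr => i _; rewrite /bump /= addnS.
Qed.

Let w : R := 2 * pi / N%:R.

Let NR : (0:R) < N%:R. Proof. by rewrite ltr0n. Qed.

Let Nw (j : nat) : N%:R * (j%:R * w) = pi * 2 * j%:R.
Proof. by rewrite /w; field; rewrite gt_eqF. Qed.

(** Orthogonality of the characters of Z/N, in real form. *)
Lemma sum_cos_orthogonal (i l : nat) : (i < N)%N -> (l < N)%N ->
  \sum_(j < N) cos (i%:R * (j%:R * w) - l%:R * (j%:R * w)) =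
  N%:R * (i == l)%:R.
Proof.
wlog li : i l / (l <= i)%N.
  move=> H iN lN; have [/H->//|/ltnW il] := leqP l i.
  rewrite eq_sym -(H _ _ il)//.
  by apply: eq_bigr => j _; rewrite -cosN opprB.
move=> iN lN; have [<-|il] := eqVneq i l.
  under eq_bigr do rewrite subrr cos0.
  by rewrite sumr_const card_ord mulr1.
rewrite mulr0.
have ltli : (l < i)%N by rewrite ltn_neqAle eq_sym il.
have lR : (l%:R : R) < i%:R by rewrite ltr_nat.
pose h := (i - l)%:R * w.
have hE : h = i%:R * w - l%:R * w by rewrite /h natrB// mulrBl.
have s0 : 0 < sin (h / 2).
  have -> : h / 2 = pi * ((i - l)%:R / N%:R) by rewrite /h /w; field; rewrite gt_eqF.
  apply: sin_gt0_pi; rewrite mulr_gt0 ?pi_gt0 ?divr_gt0 ?ltr0n ?subn_gt0//=.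
  rewrite gtr_pMr ?pi_gt0// ltr_pdivrMr// mul1r ltr_nat.
  by rewrite (leq_ltn_trans (leq_subr _ _)).
have := sum_cos_arith 0 h N; rewrite !sub0r !add0r.
have -> : N%:R * h - h / 2 = - (h / 2) + pi * 2 * (i - l)%:R.
  by rewrite /h Nw addrC.
rewrite sinD2pin subrr => /eqP; rewrite !mulf_eq0 pnatr_eq0/= gt_eqF//= => /eqP S0.
rewrite -[RHS]S0; apply: eq_bigr => j _; rewrite add0r hE; congr cos; ring.
Qed.

Definition dft_cos p (j : nat) : R := \sum_(i < N) p i * cos (i%:R * (j%:R * w)).
Definition dft_sin p (j : nat) : R := \sum_(i < N) p i * sin (i%:R * (j%:R * w)).

Lemma discrete_parseval p :
  \sum_(j < N) (dft_cos p j ^+ 2 + dft_sin p j ^+ 2) = N%:R * \sum_(i < N) p i ^+ 2.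
Proof.
transitivity (\sum_(j < N) \sum_(i < N) \sum_(l < N)
    p i * p l * cos (i%:R * (j%:R * w) - l%:R * (j%:R * w))).
  apply: eq_bigr => j _; rewrite !expr2 !mulr_suml -big_split/=.
  apply: eq_bigr => i _; rewrite !mulr_sumr -big_split/=.
  by apply: eq_bigr => l _; rewrite cosB; ring.
rewrite exchange_big mulr_sumr; apply: eq_bigr => i _ /=.
rewrite exchange_big (bigD1 i)//= [X in _ + X]big1 ?addr0 => [|l li].
  by rewrite -mulr_sumr sum_cos_orthogonal// eqxx mulr1; ring.
rewrite -mulr_sumr sum_cos_orthogonal// (_ : (_ == _) = false) ?mulr0//.
by apply/negbTE; rewrite eq_sym.
Qed.

Lemma dft_shift p m j : (forall i, p (i + N)%N = p i) ->
  let a := m%:R * (j%:R * w) in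
  dft_cos (fun i => p (i + m)%N) j = dft_cos p j * cos a + dft_sin p j * sin a /\
  dft_sin (fun i => p (i + m)%N) j = dft_sin p j * cos a - dft_cos p j * sin a.
Proof.
move=> pN a.
have e i : i%:R * (j%:R * w) = (i + m)%:R * (j%:R * w) - a.
  by rewrite natrD /a; ring.
have eN i : (i + N)%:R * (j%:R * w) = i%:R * (j%:R * w) + pi * 2 * j%:R.
  by rewrite natrD mulrDl Nw.
split.
- transitivity (\sum_(i < N) p (i + m)%N * cos ((i + m)%:R * (j%:R * w) - a)).
    by apply: eq_bigr => i _; rewrite e.
  rewrite (sum_periodic_shift (p := fun i => p i * cos (i%:R * (j%:R * w) - a))).
    rewrite /dft_cos /dft_sin !mulr_suml -big_split/=.
    by apply: eq_bigr => i _; rewrite cosB; ring.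
  by move=> i; rewrite pN eN addrAC cosD2pin.
- transitivity (\sum_(i < N) p (i + m)%N * sin ((i + m)%:R * (j%:R * w) - a)).
    by apply: eq_bigr => i _; rewrite e.
  rewrite (sum_periodic_shift (p := fun i => p i * sin (i%:R * (j%:R * w) - a))).
    rewrite /dft_cos /dft_sin !mulr_suml -sumrB/=.
    by apply: eq_bigr => i _; rewrite sinB; ring.
  by move=> i; rewrite pN eN addrAC sinD2pin.
Qed.

(** A shift by [m] rotates the [j]-th Fourier coefficient by the angle
[a = m j w]; subtracting the identity multiplies its squared modulus by
[|e^(i a) - 1|^2 = 4 sin^2 (a / 2)]. *)
Lemma dft_chord_energy p m j : (forall i, p (i + N)%N = p i) ->
  let q i := p (i + m)%N - p i in
  dft_cos q j ^+ 2 + dft_sin q j ^+ 2 =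
  4 * sin (m%:R * (j%:R * (pi / N%:R))) ^+ 2 * (dft_cos p j ^+ 2 + dft_sin p j ^+ 2).
Proof.
move=> pN q; have [ec es] := dft_shift m j pN.
set a := m%:R * (j%:R * w) in ec es.
have -> : m%:R * (j%:R * (pi / N%:R)) = a / 2.
  by rewrite /a /w; field; rewrite gt_eqF.
have -> : dft_cos q j = dft_cos p j * cos a + dft_sin p j * sin a - dft_cos p j.
  by rewrite -ec -sumrB; apply: eq_bigr => i _; rewrite mulrBl.
have -> : dft_sin q j = dft_sin p j * cos a - dft_cos p j * sin a - dft_sin p j.
  by rewrite -es -sumrB; apply: eq_bigr => i _; rewrite mulrBl.
have -> : 4 * sin (a / 2) ^+ 2 = 2 * (1 - cos a) by rewrite -sin_half_sqr; ring.
set C := dft_cos p j; set S := dft_sin p j.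
transitivity ((C ^+ 2 + S ^+ 2) * (cos a ^+ 2 + sin a ^+ 2) +
   (C ^+ 2 + S ^+ 2) * (1 - 2 * cos a)); first ring.
by rewrite cos2Dsin2; ring.
Qed.

End DiscreteFourier.

(** The discrete Wirtinger-type inequality behind the upper bound: by
Parseval it is enough to compare the two sides frequency by frequency. *)
Lemma sum_sqr_chord_le (R : realType) (k m : nat) (p : nat -> R)
    (N := (k * m)%N) (x := pi / N%:R : R) :
  (0 < k)%N -> (0 < m)%N -> (forall i, p (i + N)%N = p i) ->
  (\sum_(i < N) (p (i + m)%N - p i) ^+ 2) * sin x ^+ 2 <=
  sin (m%:R * x) ^+ 2 * \sum_(i < N) (p i.+1 - p i) ^+ 2.
Proof.
move=> k0 m0 pN.
have N0 : (0 < N)%N by rewrite muln_gt0 k0.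
have NR : (0:R) < N%:R by rewrite ltr0n.
under [X in _ <= _ * X]eq_bigr do rewrite -addn1.
rewrite -(ler_pM2l NR) mulrA [leRHS]mulrCA.
rewrite -(discrete_parseval N0 (fun i => p (i + m)%N - p i)).
rewrite -(discrete_parseval N0 (fun i => p (i + 1)%N - p i)).
rewrite mulr_suml mulr_sumr; apply: ler_sum => j _.
rewrite !dft_chord_energy// mul1r mulrAC [leRHS]mulrA.
apply: ler_wpM2r; first by rewrite addr_ge0 ?sqr_ge0.
rewrite -mulrA [leRHS]mulrCA ler_wpM2l// -!exprMn.
rewrite -[leLHS]real_normK ?num_real// -[leRHS]real_normK ?num_real//.
rewrite !normrM lerXn2r ?nnegrE ?mulr_ge0//.
have x0 : 0 <= x by rewrite divr_ge0 ?pi_ge0// ltW.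
have xpi : x <= pi by rewrite ler_pdivrMr// ler_peMr ?pi_ge0// ler1n.
have mxpi : m%:R * x <= pi.
  rewrite mulrA ler_pdivrMr// mulrC ler_wpM2l ?pi_ge0// ler_nat.
  by rewrite leq_pmull.
have sx : 0 <= sin x by rewrite sin_ge0_pi// x0.
have smx : 0 <= sin (m%:R * x) by rewrite sin_ge0_pi// mulr_ge0.
rewrite (ger0_norm sx) (ger0_norm smx).
by apply: norm_sin_mul_le => //; exact: ltnW.
Qed.

(** * The Euclidean norm *)

Section EuclideanNorm.
Variables (R : realType) (d : nat).
Implicit Types u v w : 'rV[R]_d.

Definition dot u v : R := \sum_(i < d) u 0 i * v 0 i.

Lemma enorm_ge0 v : 0 <= enorm v.
Proof. exact: sqrtr_ge0. Qed.

Lemma sqr_enorm v : enorm v ^+ 2 = \sum_(i < d) v 0 i ^+ 2.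
Proof. by rewrite sqr_sqrtr// sumr_ge0// => i _; exact: sqr_ge0. Qed.

Lemma enorm_eq0 v : enorm v = 0 -> v = 0.
Proof.
move=> v0; apply/rowP => i; rewrite mxE; apply/eqP; rewrite -sqrf_eq0.
have := sqr_enorm v; rewrite v0 expr0n/= => /esym/eqP.
by rewrite psumr_eq0 => [/allP/(_ i)/(_ (mem_index_enum _))//|j _]; exact: sqr_ge0.
Qed.

(** The Cauchy-Schwarz inequality, from the expansion of
[| |v| u - |u| v |^2 >= 0]. *)
Lemma dot_le u v : dot u v <= enorm u * enorm v.
Proof.
have [u0|u0] := eqVneq (enorm u) 0.
  by rewrite u0 mul0r /dot big1// => i _; rewrite (enorm_eq0 u0) mxE mul0r.
have [v0|v0] := eqVneq (enorm v) 0.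
  by rewrite v0 mulr0 /dot big1// => i _; rewrite (enorm_eq0 v0) mxE mulr0.
have uv0 : 0 < enorm u * enorm v by rewrite mulr_gt0// lt0r enorm_ge0 andbT.
rewrite -(ler_pM2l uv0) -subr_ge0.
have : 0 <= \sum_(i < d) (enorm v * u 0 i - enorm u * v 0 i) ^+ 2.
  by apply: sumr_ge0 => i _; exact: sqr_ge0.
have -> : \sum_(i < d) (enorm v * u 0 i - enorm u * v 0 i) ^+ 2 =
   enorm v ^+ 2 * (\sum_(i < d) u 0 i ^+ 2) + enorm u ^+ 2 * (\sum_(i < d) v 0 i ^+ 2)
   - 2 * (enorm u * enorm v) * dot u v.
  rewrite /dot !mulr_sumr -big_split/= -sumrB; apply: eq_bigr => i _; ring.
rewrite -!sqr_enorm; lra.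
Qed.

Lemma enormD u v : enorm (u + v) <= enorm u + enorm v.
Proof.
rewrite -(@ler_pXn2r _ 2)// ?nnegrE ?addr_ge0 ?enorm_ge0//.
have -> : enorm (u + v) ^+ 2 = enorm u ^+ 2 + enorm v ^+ 2 + 2 * dot u v.
  rewrite !sqr_enorm /dot mulr_sumr -!big_split/=.
  by apply: eq_bigr => i _; rewrite mxE; ring.
by have := dot_le u v; rewrite sqrrD mulr2n; lra.
Qed.

Lemma enormZ (a : R) v : enorm (a *: v) = `|a| * enorm v.
Proof.
apply/eqP; rewrite -(@eqrXn2 _ 2) ?mulr_ge0 ?enorm_ge0//.
rewrite exprMn !sqr_enorm real_normK ?num_real// mulr_sumr; apply/eqP.
by apply: eq_bigr => i _; rewrite mxE exprMn.
Qed.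

Lemma enormN v : enorm (- v) = enorm v.
Proof. by rewrite -scaleN1r enormZ normrN1 mul1r. Qed.

Lemma enorm0 : enorm (0 : 'rV[R]_d) = 0.
Proof. by rewrite -(scale0r (0 : 'rV[R]_d)) enormZ normr0 mul0r. Qed.

Lemma enorm_distC u v : enorm (u - v) = enorm (v - u).
Proof. by rewrite -enormN opprB. Qed.

Lemma norm_coord_le_enorm v i : `|v 0 i| <= enorm v.
Proof.
rewrite -(@ler_pXn2r _ 2)// ?nnegrE ?enorm_ge0// real_normK ?num_real// sqr_enorm.
by rewrite (bigD1 i)//= lerDl sumr_ge0// => j _; exact: sqr_ge0.
Qed.

Lemma norm_le_enorm v : `|v| <= enorm v.
Proof.
rewrite /Num.Def.normr/= mx_normrE; apply/bigmax_leP; split; first exact: enorm_ge0.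
by move=> [i j] _ /=; rewrite ord1 norm_coord_le_enorm.
Qed.

End EuclideanNorm.

(** * Length of curves *)

Section CurveLength.
Variables (R : realType) (d : nat).
Implicit Types g : R -> 'rV[R]_d.

Lemma polygon_length_cons g a x s :
  polygon_length g a (x :: s) = enorm (g x - g a) + polygon_length g x s.
Proof. by rewrite /polygon_length /= big_cons. Qed.

Lemma polygon_length_nil g a : polygon_length g a [::] = 0.
Proof. by rewrite /polygon_length big_nil. Qed.

(** A control function [phi] bounds the length of [g] because its increments
telescope along every partition; this replaces additivity of the length under
concatenation. *)
Lemma curve_length_le g (phi : R -> R) a b :
  (forall x y, x <= y -> enorm (g y - g x) <= phi y - phi x) ->
  (curve_length g a b <= (phi b - phi a)%:E)%E.
Proof.
move=> H; apply: ge_ereal_sup => _ [s [ps ls]] <-; rewrite lee_fin.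
elim: s a ps ls => [|x s IH] a /=.
  by move=> _ /eqP ->; rewrite polygon_length_nil subrr.
move=> /andP[/ltW ax] ps ls; rewrite polygon_length_cons.
by have := IH x ps ls; have := H _ _ ax; lra.
Qed.

Lemma enorm_le_curve_length g a b : a < b ->
  ((enorm (g b - g a))%:E <= curve_length g a b)%E.
Proof.
move=> ab; apply: ereal_sup_ubound; exists [:: b]; first exact: itv_partition1.
by rewrite polygon_length_cons polygon_length_nil addr0.
Qed.

Lemma closed_curve_lipschitz (C : closed_curve R d) x y : x <= y ->
  enorm (C y - C x) <= y - x.
Proof.
rewrite le_eqVlt => /orP[/eqP ->|xy]; first by rewrite !subrr enorm0.
rewrite -lee_fin -(cparam_arc_length C (ltW xy)).
exact: enorm_le_curve_length.
Qed.

Lemma lipschitz_continuous g K :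
  (forall x y, x <= y -> enorm (g y - g x) <= K * (y - x)) -> continuous g.
Proof.
move=> H.
have D x y : enorm (g x - g y) <= (`|K| + 1) * `|x - y|.
  wlog xy : x y / y <= x.
    move=> W; have [/W//|/ltW/W] := leP y x.
    by rewrite enorm_distC distrC.
  apply: (le_trans (H _ _ xy)); rewrite [`|x - y|]ger0_norm ?subr_ge0//.
  by rewrite ler_wpM2r ?subr_ge0// (le_trans (ler_norm K))// lerDl.
move=> x; apply/cvgrPdist_le => e e0.
have K1 : 0 < `|K| + 1 by rewrite ltr_wpDl.
near=> y.
apply: (le_trans (norm_le_enorm _)); apply: (le_trans (D _ _)).
rewrite -ler_pdivlMl//; near: y.
by apply: (@cvgr_dist_le _ _ _ (nbhs x) _ id x _) => //; rewrite mulr_gt0 ?invr_gt0.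
Unshelve. all: by end_near. Qed.

End CurveLength.

(** * Closed curves made of an arc and its chord *)

Section Arcs.
Variables (R : realType) (d : nat) (C : closed_curve R d).

(** The arc from [u] to [u + a] is traversed for [x <= 1 / 2], its chord
afterwards. Clamping the two phases with [min] and [max] avoids any case
distinction on [x], and makes the map Lipschitz on the whole line. *)
Definition arc_tour (u a x : R) : 'rV[R]_d :=
  C (u + Num.min (2 * a * x) a) + Num.max 0 (2 * x - 1) *: (C u - C (u + a)).

(** The control function is the length travelled up to time [x]. *)
Lemma arc_tour_control (u a : R) x y : 0 <= a -> x <= y ->
  enorm (arc_tour u a y - arc_tour u a x) <=
  (Num.min (2 * a * y) a + Num.max 0 (2 * y - 1) * enorm (C u - C (u + a))) -
  (Num.min (2 * a * x) a + Num.max 0 (2 * x - 1) * enorm (C u - C (u + a))).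
Proof.
move=> a0 xy; rewrite /arc_tour.
have axy : 2 * a * x <= 2 * a * y by rewrite ler_wpM2l// mulr_ge0.
have m1 : Num.min (2 * a * x) a <= Num.min (2 * a * y) a by rewrite le_min2.
have m2 : Num.max 0 (2 * x - 1) <= Num.max 0 (2 * y - 1) by rewrite le_max2//; lra.
rewrite opprD addrACA -scalerBl.
apply: (le_trans (enormD _ _)); rewrite enormZ (ger0_norm (x := _ - _)) ?subr_ge0//.
have : u + Num.min (2 * a * x) a <= u + Num.min (2 * a * y) a by rewrite lerD2l.
by move=> /(closed_curve_lipschitz C); lra.
Qed.

Lemma curve_length_arc_tour (u a : R) : 0 <= a ->
  (curve_length (arc_tour u a) 0 1 <= (a + enorm (C u - C (u + a)))%:E)%E.
Proof.
move=> a0; apply: le_trans.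
  apply: (@curve_length_le _ _ (arc_tour u a)) => x y.
  exact: arc_tour_control.
have -> : Num.min (2 * a * 0) a = 0 by rewrite mulr0; exact/min_idPl.
have -> : Num.min (2 * a * 1) a = a by apply/min_idPr; lra.
have -> : Num.max 0 (2 * 0 - 1) = 0 :> R by apply/max_idPl; lra.
have -> : Num.max 0 (2 * 1 - 1) = 1 :> R by rewrite (max_idPr _); lra.
by rewrite lee_fin; lra.
Qed.

Lemma closed_path_arc_tour (u a : R) : 0 <= a -> closed_path (arc_tour u a).
Proof.
move=> a0; split.
  apply: continuous_subspaceT.
  apply: (@lipschitz_continuous _ _ _ (2 * a + 2 * enorm (C u - C (u + a)))) => x y xy.
  apply: (le_trans (arc_tour_control u a0 xy)).
  set c := enorm _; have c0 : 0 <= c by exact: enorm_ge0.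
  have : Num.min (2 * a * y) a - Num.min (2 * a * x) a <= 2 * a * (y - x).
    rewrite lerBlDr; have axy : 2 * a * x <= 2 * a * y by rewrite ler_wpM2l// mulr_ge0.
    by case: (leP (2 * a * x) a) => ?; case: (leP (2 * a * y) a) => ?; lra.
  have : Num.max 0 (2 * y - 1) - Num.max 0 (2 * x - 1) <= 2 * (y - x).
    by case: (leP 0 (2 * x - 1)) => ?; case: (leP 0 (2 * y - 1)) => ?; lra.
  by move=> /(ler_wpM2r c0); lra.
rewrite /arc_tour.
have -> : Num.min (2 * a * 0) a = 0 by rewrite mulr0; exact/min_idPl.
have -> : Num.min (2 * a * 1) a = a by apply/min_idPr; lra.
have -> : Num.max 0 (2 * 0 - 1) = 0 :> R by apply/max_idPl; lra.
have -> : Num.max 0 (2 * 1 - 1) = 1 :> R by rewrite (max_idPr _); lra.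
by rewrite addr0 scale0r scale1r addr0 addrC subrK.
Qed.

Lemma arc_tour_covers (u a t : R) : 0 < a -> u <= t <= u + a ->
  exists2 x, 0 <= x <= 1 & arc_tour u a x = C t.
Proof.
move=> a0 /andP[ut ta]; exists ((t - u) / (2 * a)).
  by rewrite ler_pdivlMr ?ler_pdivrMr ?mulr_gt0// mul0r; lra.
rewrite /arc_tour.
have -> : 2 * a * ((t - u) / (2 * a)) = t - u by field; rewrite gt_eqF.
have -> : 2 * ((t - u) / (2 * a)) = (t - u) / a by field; rewrite gt_eqF.
have -> : Num.min (t - u) a = t - u by apply/min_idPl; lra.
have -> : Num.max 0 ((t - u) / a - 1) = 0.
  by apply/max_idPl; rewrite subr_le0 ler_pdivrMr// mul1r; lra.
by rewrite scale0r addr0 addrC subrK.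
Qed.

Lemma w_subset_arc_le (S : set R) (u a : R) : 0 < a ->
  (forall t, S t -> (u <= t <= u + a) || (u <= t + clen C <= u + a)) ->
  (w_subset C S <= (a + enorm (C u - C (u + a)))%:E)%E.
Proof.
move=> a0 HS; apply: le_trans (curve_length_arc_tour u (ltW a0)).
apply: ereal_inf_lbound; exists (arc_tour u a) => //; split.
  exact/closed_path_arc_tour/ltW.
move=> _ [t St <-]; case/orP: (HS t St) => /(arc_tour_covers a0)[x x01 e];
  by exists x; rewrite /= ?in_itv//= e// cparam_periodic.
Qed.

End Arcs.

(** * Partitions of a curve into equal arcs *)

Lemma set_itvcoE (R : realType) (y z x : R) : `[y, z[%classic x = (y <= x < z) :> Prop.
Proof. by rewrite /= in_itv. Qed.

Section EqualArcs.
Variables (R : realType) (k : nat) (a tau : R).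
Hypotheses (k0 : (0 < k)%N) (a0 : 0 < a) (tau0 : 0 <= tau) (taua : tau < a).
Let L := k%:R * a.

(** The arc number [s] of length [a] from the offset [tau], inside the
fundamental domain [[0, L[]: its second interval is empty, except for the
last arc, which wraps around. *)
Definition cyclic_arc (s : nat) : set R :=
  `[tau + s%:R * a, Num.min L (tau + s.+1%:R * a)[ `|`
  `[0, Num.max 0 (tau + s.+1%:R * a - L)[.

Lemma cyclic_arcP s x : (s < k)%N ->
  cyclic_arc s x <-> [/\ 0 <= x, x < L &
    (tau + s%:R * a <= x < tau + s.+1%:R * a) ||
    (tau + s%:R * a <= x + L < tau + s.+1%:R * a)].
Proof.
have [[pos_a ge0_tau] lt_tau_a] := ((a0, tau0), taua).
move=> sk.
have sa : 0 <= s%:R * a by rewrite mulr_ge0// ltW.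
have sL : s.+1%:R * a <= L by rewrite ler_wpM2r ?ler_nat// ltW.
rewrite -natr1 mulrDl mul1r in sL.
have setUE (A B : set R) : (A `|` B) x = (A x \/ B x) by [].
rewrite /cyclic_arc setUE !set_itvcoE -natr1 mulrDl mul1r lt_min lt_max.
split=> [[/and3P[h1 h2 h3]|/andP[h1 /orP[h2|h2]]]|
         [h1 h2 /orP[/andP[h3 h4]|/andP[h3 h4]]]].
- by split; [lra|lra|rewrite h1 h3].
- by lra.
- by split; [lra|lra|apply/orP; right; apply/andP; split; lra].
- by left; rewrite h3 h2 h4.
- by right; rewrite h1; apply/orP; right; lra.
Qed.

Lemma cyclic_arc_measurable s : measurable (cyclic_arc s : set R).
Proof. by apply: measurableU; exact: measurable_itv. Qed.

Lemma cyclic_arc_measure s : (s < k)%N ->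
  lebesgue_measure (cyclic_arc s) = a%:E.
Proof.
have [[pos_a ge0_tau] lt_tau_a] := ((a0, tau0), taua).
move=> sk.
have sa : 0 <= s%:R * a by rewrite mulr_ge0// ltW.
have sL : s.+1%:R * a <= L by rewrite ler_wpM2r ?ler_nat// ltW.
rewrite -natr1 mulrDl mul1r in sL.
rewrite /cyclic_arc measureU//=; last first.
  apply/seteqP; split => // x []; rewrite !set_itvcoE -natr1 mulrDl mul1r => /andP[h1 _].
  by rewrite lt_max => /andP[h2 /orP[h3|h3]]; lra.
rewrite !lebesgue_measure_itv/= !lte_fin -natr1 mulrDl mul1r.
case: (leP L (tau + (s%:R * a + a))) => h1;
  case: (leP 0 (tau + (s%:R * a + a) - L)) => h2; [|exfalso; lra|exfalso; lra|].
- case: ifPn => [h3|]; last by rewrite -leNgt => ?; exfalso; lra.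
  case: ifPn => [h4|]; last rewrite -leNgt => h4;
    rewrite -?EFinN -!EFinD ?adde0; congr EFin; lra.
- by rewrite ltxx adde0 ifT -?EFinN -?EFinD; [congr EFin|]; lra.
Qed.

Lemma trivIset_cyclic_arc : trivIset setT (fun s : 'I_k => cyclic_arc s).
Proof.
have [[pos_a ge0_tau] lt_tau_a] := ((a0, tau0), taua).
apply/trivIsetP => i j _ _; wlog ij : i j / (i < j)%N.
  move=> W ij; have [|] := ltnP i j; first by move/W; apply.
  rewrite leq_eqVlt => /orP[/eqP/val_inj ji|/W].
    by rewrite ji eqxx in ij.
  by rewrite setIC eq_sym; apply.
move=> _; apply/seteqP; split => // x [].
move=> /(cyclic_arcP _ (ltn_ord i))[x0 xL hi] /(cyclic_arcP _ (ltn_ord j))[_ _ hj].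
have ijR : i.+1%:R * a <= j%:R * a by rewrite ler_wpM2r ?ler_nat// ltW.
have jL : j.+1%:R * a <= L by rewrite ler_wpM2r ?ler_nat// ltW.
have ia : 0 <= i%:R * a by rewrite mulr_ge0// ltW.
have e : j.+1%:R * a = j%:R * a + a by rewrite -natr1 mulrDl mul1r.
by case/orP: hi => /andP[? ?]; case/orP: hj => /andP[? ?]; lra.
Qed.

Lemma bigcup_cyclic_arc : \bigcup_(s : 'I_k) cyclic_arc s = `[0, L[%classic.
Proof.
have [[pos_a ge0_tau] lt_tau_a] := ((a0, tau0), taua).
apply/seteqP; split => [x [s _ /(cyclic_arcP _ (ltn_ord s))[h0 h1 _]]|x].
  by rewrite set_itvcoE h0 h1.
rewrite set_itvcoE => /andP[x0 xL].
have kE : k.-1.+1 = k by rewrite prednK.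
have LE : L = k.-1%:R * a + a by rewrite /L -{1}kE -natr1 mulrDl mul1r.
have [tx|xt] := leP tau x; last first.
  have lk : (k.-1 < k)%N by rewrite ltn_predL.
  (* Points before the offset belong to the last arc. *)
  exists (Ordinal lk) => //; apply/cyclic_arcP => //=; split => //.
  apply/orP; right; rewrite kE -/L; lra.
have [/truncn_itv/= /andP[h1 h2]] : 0 <= (x - tau) / a.
  by rewrite divr_ge0 ?subr_ge0// ltW.
set s := Num.truncn _ in h1 h2.
rewrite ler_pdivlMr// in h1; rewrite ltr_pdivrMr// in h2.
have sk : (s < k)%N.
  rewrite -(ltr_nat R) -(ltr_pM2r a0) -/L; lra.
exists (Ordinal sk) => //; apply/cyclic_arcP => //=; split => //.
by apply/orP; left; lra.
Qed.

End EqualArcs.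

Lemma cyclic_arc_equal_partition (R : realType) (d : nat)
    (C : closed_curve R d) (k : nat) (a := clen C / k%:R) (tau : R) :
  (0 < k)%N -> 0 <= tau < a ->
  equal_partition C (fun s : 'I_k => cyclic_arc k a tau s).
Proof.
move=> k0 /andP[tau0 taua].
have kR : (0:R) < k%:R by rewrite ltr0n.
have a0 : 0 < a by rewrite divr_gt0// clen_gt0.
have La : clen C = k%:R * a by rewrite /a mulrC divfK// gt_eqF.
split.
- by rewrite La; exact: bigcup_cyclic_arc.
- exact: trivIset_cyclic_arc.
- move=> s; exists (tau + s%:R * a); apply/cyclic_arcP => //.
  have sL : s.+1%:R * a <= k%:R * a by rewrite ler_wpM2r ?ler_nat// ltW.
  have sa : 0 <= s%:R * a by rewrite mulr_ge0// ltW.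
  move: sL; rewrite -natr1 mulrDl mul1r => sL.
  by split; try lra; apply/orP; left; lra.
- by move=> s; apply: sub_caratheodory; exact: cyclic_arc_measurable.
- by move=> s; exact: cyclic_arc_measure.
Qed.

(** * The upper bound *)

Lemma sum_by_residue (V : nmodType) (k m : nat) (F : nat -> V) :
  \sum_(i < k * m) F i = \sum_(t < m) \sum_(s < k) F (s * m + t)%N.
Proof.
rewrite exchange_big /=; elim: k => [|k IH]; first by rewrite mul0n !big_ord0.
by rewrite mulSnr big_split_ord big_ord_recr /= IH.
Qed.

Lemma sqr_sum_le (R : realFieldType) (n : nat) (x : 'I_n -> R) :
  (\sum_i x i) ^+ 2 <= n%:R * \sum_i x i ^+ 2.
Proof.
have : 0 <= \sum_(i < n) \sum_(j < n) (x i - x j) ^+ 2.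
  by apply: sumr_ge0 => i _; apply: sumr_ge0 => j _; exact: sqr_ge0.
(* Lagrange's identity. *)
suff -> : \sum_(i < n) \sum_(j < n) (x i - x j) ^+ 2 =
    2 * (n%:R * \sum_i x i ^+ 2 - (\sum_i x i) ^+ 2).
  by rewrite pmulr_rge0// subr_ge0.
transitivity (\sum_(i < n) (n%:R * x i ^+ 2 + \sum_j x j ^+ 2 - 2 * x i * \sum_j x j)).
  apply: eq_bigr => i _.
  transitivity (\sum_(j < n) (x i ^+ 2 + x j ^+ 2 - 2 * x i * x j)).
    by apply: eq_bigr => j _; ring.
  by rewrite sumrB big_split/= sumr_const card_ord -mulr_sumr -[_ *+ n]mulr_natl.
rewrite sumrB big_split/= sumr_const card_ord -!mulr_sumr -!mulr_suml -mulr_sumr.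
by rewrite -[_ *+ n]mulr_natl; ring.
Qed.

Section UpperBound.
Variables (R : realType) (d : nat) (C : closed_curve R d).

(** The quadratic inequality is summed over the coordinates, and turned into a
linear one by Cauchy-Schwarz; the steps [P i.+1 - P i] are controlled by the
arc-length parameterization. *)
Lemma sum_chord_le (k m : nat) (N := (k * m)%N)
    (P := fun i : nat => C (i%:R * (clen C / N%:R))) :
  (0 < k)%N -> (0 < m)%N ->
  (\sum_(i < N) enorm (P (i + m)%N - P i)) * sin (pi / N%:R) <=
  clen C * sin (pi / k%:R).
Proof.
move=> k0 m0.
have N0 : (0 < N)%N by rewrite muln_gt0 k0.
have NR : (0:R) < N%:R by rewrite ltr0n.
have kR : (0:R) < k%:R by rewrite ltr0n.
have mR : (0:R) < m%:R by rewrite ltr0n.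
have L0 := clen_gt0 C.
have PN i : P (i + N)%N = P i.
  by rewrite /P natrD mulrDl mulrC [N%:R * _]mulrC divfK ?gt_eqF// mulrC cparam_periodic.
have Pstep i : enorm (P i.+1 - P i) <= clen C / N%:R.
  rewrite /P; apply: le_trans; first apply: closed_curve_lipschitz.
    by rewrite ler_wpM2r ?ler_nat// divr_ge0// ltW.
  by rewrite -mulrBl -natr1 addrC addKr mul1r.
set x := pi / N%:R : R.
have mx : m%:R * x = pi / k%:R.
  by rewrite /x /N natrM; field; rewrite !gt_eqF.
have kR1 : (1:R) <= k%:R by rewrite ler1n.
have NR1 : (1:R) <= N%:R by rewrite ler1n.
have sx : 0 <= sin x.
  by rewrite sin_ge0_pi// divr_ge0 ?pi_ge0//= ?ler_pdivrMr ?ler_peMr ?pi_ge0// ltW.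
have sk : 0 <= sin (pi / k%:R : R).
  by rewrite sin_ge0_pi// divr_ge0 ?pi_ge0//= ?ler_pdivrMr ?ler_peMr ?pi_ge0// ltW.
have sum0 : 0 <= \sum_(i < N) enorm (P (i + m)%N - P i).
  by apply: sumr_ge0 => i _; exact: enorm_ge0.
rewrite -(@ler_pXn2r _ 2)// ?nnegrE ?mulr_ge0// ?(ltW L0)// !exprMn.
apply: (@le_trans _ _
    (N%:R * (\sum_(i < N) enorm (P (i + m)%N - P i) ^+ 2) * sin x ^+ 2)).
  by rewrite ler_wpM2r ?sqr_ge0// sqr_sum_le.
rewrite -mulrA.
apply: (@le_trans _ _ (N%:R *
    (sin (m%:R * x) ^+ 2 * \sum_(i < N) enorm (P i.+1 - P i) ^+ 2))).
  rewrite ler_wpM2l ?(ltW NR)//.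
  have E (F : nat -> 'rV[R]_d) :
      \sum_(i < N) enorm (F i) ^+ 2 = \sum_(c < d) \sum_(i < N) F i 0 c ^+ 2.
    by rewrite exchange_big; apply: eq_bigr => i _; exact: sqr_enorm.
  rewrite (E (fun i => P (i + m)%N - P i)) (E (fun i => P i.+1 - P i)).
  rewrite mulr_suml mulr_sumr.
  apply: ler_sum => c _.
  have := @sum_sqr_chord_le R k m (fun i => P i 0 c) k0 m0.
  have : forall i : nat, P (i + N)%N 0 c = P i 0 c by move=> i; rewrite PN.
  rewrite -/N -/x => h /(_ h).
  have D i j : (P i - P j) 0 c = P i 0 c - P j 0 c by rewrite !mxE.
  have S1 : \sum_(i < N) (P (i + m)%N - P i) 0 c ^+ 2 =
      \sum_(i < N) (P (i + m)%N 0 c - P i 0 c) ^+ 2.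
    by apply: eq_bigr => i _; rewrite D.
  have S2 : \sum_(i < N) (P i.+1 - P i) 0 c ^+ 2 =
      \sum_(i < N) (P i.+1 0 c - P i 0 c) ^+ 2.
    by apply: eq_bigr => i _; rewrite D.
  by rewrite S1 S2.
rewrite mx mulrCA mulrC ler_wpM2r ?sqr_ge0//.
apply: (@le_trans _ _ (N%:R * \sum_(i < N) (clen C / N%:R) ^+ 2)).
  rewrite ler_wpM2l ?(ltW NR)//; apply: ler_sum => i _.
  by rewrite lerXn2r ?nnegrE ?enorm_ge0// divr_ge0// ltW.
rewrite sumr_const card_ord -[X in N%:R * X]mulr_natl.
by rewrite le_eqVlt; apply/orP; left; apply/eqP; field; rewrite gt_eqF.
Qed.

(** The [N] chords are grouped according to their residue [t] modulo [m]: each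
group consists of the chords of one partition into [k] arcs, and some group
is at most the average. For [m = 1] and [k = 1] the sine in the denominator
would vanish. *)
Lemma beta_curve_le_discrete (k m : nat) : (0 < k)%N -> (1 < m)%N ->
  (beta_curve C k <=
   (k%:R^-1 + sin (pi / k%:R) / ((k * m)%:R * sin (pi / (k * m)%:R)))%:E)%E.
Proof.
move=> k0 m1; have m0 : (0 < m)%N by exact: ltnW.
set N := (k * m)%N.
have N1 : (1 < N)%N by rewrite (leq_trans m1)// leq_pmull.
have L0 := clen_gt0 C.
have kR : (0:R) < k%:R by rewrite ltr0n.
have mR : (0:R) < m%:R by rewrite ltr0n.
have NR : (0:R) < N%:R by rewrite ltr0n ltnW.
have sN : 0 < sin (pi / N%:R : R).
  rewrite sin_gt0_pi// divr_gt0 ?pi_gt0//= ltr_pdivrMr// ltr_pMr ?pi_gt0//.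
  by rewrite ltr1n.
pose P (i : nat) := C (i%:R * (clen C / N%:R)).
have SP : \sum_(t < m) \sum_(s < k)
      enorm (P (s * m + t + m)%N - P (s * m + t)%N) <=
    clen C * sin (pi / k%:R) / sin (pi / N%:R).
  rewrite -(sum_by_residue k m (fun i => enorm (P (i + m)%N - P i))) ler_pdivlMr//.
  exact: sum_chord_le.
(* Pigeonhole: some residue class is at most the average. *)
have [t Ht] : exists t : 'I_m,
    m%:R * (\sum_(s < k) enorm (P (s * m + t + m)%N - P (s * m + t)%N)) <=
    clen C * sin (pi / k%:R) / sin (pi / N%:R).
  apply/not_existsP => H.
  have := SP; rewrite leNgt => /negP; apply.
  rewrite -(ltr_pM2l mR) mulr_sumr.
  rewrite -[ltLHS](_ :
    \sum_(t < m) clen C * sin (pi / k%:R) / sin (pi / N%:R) = _); last first.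
    by rewrite sumr_const card_ord mulr_natl.
  apply: ltr_sum; first by apply/hasP; exists (Ordinal m0) => //; rewrite mem_index_enum.
  by move=> t _; rewrite ltNge; apply/negP/H.
pose a := clen C / k%:R.
have a0 : 0 < a by rewrite divr_gt0.
pose tau := t%:R * (clen C / N%:R).
have aN : clen C / N%:R = a / m%:R by rewrite /a /N natrM; field; rewrite !gt_eqF.
have tau0 : 0 <= tau by rewrite mulr_ge0// aN divr_ge0// ltW.
have taua : tau < a.
  by rewrite /tau aN mulrA ltr_pdivrMr// mulrC ltr_pM2l// ltr_nat.
have EP : equal_partition C (fun s : 'I_k => cyclic_arc k a tau s).
  by apply: cyclic_arc_equal_partition; rewrite ?tau0.
apply: (@le_trans _ _ (beta_partition C (fun s : 'I_k => cyclic_arc k a tau s))).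
  by apply: ereal_inf_lbound; exists (fun s : 'I_k => cyclic_arc k a tau s).
pose c (s : nat) := enorm (P (s * m + t + m)%N - P (s * m + t)%N).
have ws (s : 'I_k) : (w_subset C (cyclic_arc k a tau s) <= (a + c s)%:E)%E.
  have Pu : P (s * m + t)%N = C (tau + s%:R * a).
    by rewrite /P natrD natrM aN; congr (C _); rewrite /tau aN; field; rewrite gt_eqF.
  have Pv : P (s * m + t + m)%N = C (tau + s%:R * a + a).
    by rewrite /P !natrD natrM aN; congr (C _); rewrite /tau aN; field; rewrite gt_eqF.
  rewrite /c enorm_distC Pu Pv.
  apply: w_subset_arc_le => // x /cyclic_arcP.
  case=> //; rewrite -natr1 mulrDl mul1r addrA => x0 xL.
  have -> : k%:R * a = clen C by rewrite /a mulrC divfK// gt_eqF.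
  by move=> /orP[/andP[-> /ltW ->]|/andP[-> /ltW ->]]; rewrite ?orbT.
rewrite /beta_partition.
apply: (@le_trans _ _ (k%:R^-1%:E * (\sum_(s < k) (a + c s)%:E) * (clen C)^-1%:E)%E).
  apply: lee_wpmul2r; first by rewrite lee_fin invr_ge0 ltW.
  apply: lee_wpmul2l; first by rewrite lee_fin invr_ge0 ltW.
  by apply: lee_sum => s _; exact: ws.
rewrite sumEFin -!EFinM lee_fin big_split/= sumr_const card_ord.
rewrite -[a *+ k]mulr_natr /a divfK ?gt_eqF//.
rewrite mulrDr mulrDl mulfK ?gt_eqF// lerD2l.
rewrite -/(\sum_(s < k) c s) in Ht *.
have {}Ht : \sum_(s < k) c s <= clen C * sin (pi / k%:R) / sin (pi / N%:R) / m%:R.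
  by rewrite ler_pdivlMr// mulrC.
rewrite ler_pdivrMr// -(ler_pM2l kR) mulrA divff ?gt_eqF// mul1r.
apply: (le_trans Ht).
set z := sin (pi / N%:R) in sN *.
by rewrite le_eqVlt; apply/orP; left; apply/eqP; rewrite /N natrM; field; rewrite !gt_eqF.
Qed.

Lemma beta_curve_le (k : nat) : (0 < k)%N ->
  (beta_curve C k <= (k%:R^-1 + pi^-1 * sin (pi / k%:R))%:E)%E.
Proof.
move=> k0.
have kR : (0:R) < k%:R by rewrite ltr0n.
pose v (n : nat) : R := (k * n.+1)%:R * sin (pi / (k * n.+1)%:R).
have cv : v @ \oo --> (pi : R).
  have -> : v = (fun n : nat => k%:R * (n.+1%:R * sin ((pi / k%:R) / n.+1%:R))).
    apply/funext => n; rewrite /v natrM -mulrA; congr (_ * (_ * sin _)).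
    by field; rewrite !gt_eqF.
  rewrite -[X in _ --> X](_ : k%:R * (pi / k%:R) = _); last by field; rewrite gt_eqF.
  apply: cvgM; first exact: cvg_cst.
  by apply: cvg_mul_sin_div; rewrite divr_ge0 ?pi_ge0// ltW.
pose u (n : nat) : R := k%:R^-1 + sin (pi / k%:R) / v n.
have cu : u n @[n --> \oo] --> k%:R^-1 + pi^-1 * sin (pi / k%:R).
  apply: cvgD; first exact: cvg_cst.
  rewrite [_^-1 * _]mulrC; apply: cvgM; first exact: cvg_cst.
  exact: (cvgV (lt0r_neq0 (pi_gt0 R)) cv).
have cE : (u n)%:E @[n --> \oo] --> (k%:R^-1 + pi^-1 * sin (pi / k%:R))%:E.
  by apply: cvg_EFin; first exact: nearW.
rewrite -(cvg_lim (@ereal_hausdorff R) cE).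
apply: lime_ge; first by apply/cvg_ex; eexists; exact: cE.
near=> n; apply: beta_curve_le_discrete => //.
by near: n; exists 1%N.
Unshelve. all: by end_near. Qed.

End UpperBound.

(** * Variation of a real function along a closed polygon *)

Section Variation.
Variables (R : realType) (f : R -> R).

Definition path_variation (a : R) (s : seq R) : R :=
  \sum_(x <- zip s (a :: s)) `|f x.1 - f x.2|.

Lemma path_variation_cons a x s :
  path_variation a (x :: s) = `|f x - f a| + path_variation x s.
Proof. by rewrite /path_variation /= big_cons. Qed.

Lemma path_variation_ge_detour a s y : y \in a :: s ->
  `|f y - f a| + `|f (last a s) - f y| <= path_variation a s.
Proof.
elim: s a y => [|x s IH] a y.
  by rewrite inE => /eqP ->; rewrite /path_variation big_nil /= !subrr normr0 addr0.
rewrite inE path_variation_cons /= => /orP[/eqP ->|/IH H].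
  have := IH x x (mem_head _ _); rewrite !subrr normr0 !add0r => H.
  by have := ler_distD (f x) (f (last x s)) (f a); lra.
by have := ler_distD (f x) (f y) (f a); lra.
Qed.

(** Going from [a] around through [y] and [z] and back covers twice the distance
between the values at [y] and [z]. The last summand is [0] for closed polygons;
it makes the induction on the list possible. *)
Lemma path_variation_ge_twice a s y z : y \in a :: s -> z \in a :: s ->
  2 * `|f y - f z| <= path_variation a s + `|f (last a s) - f a|.
Proof.
elim: s a y z => [|x s IH] a y z.
  rewrite !inE => /eqP -> /eqP ->.
  by rewrite /path_variation big_nil !subrr normr0; lra.
wlog yz : y z / (z \in x :: s).
  move=> W ys; rewrite inE => /orP[/eqP ->|zs]; last first.
    by apply: W; rewrite // inE zs orbT.
  move: ys; rewrite inE => /orP[/eqP ->|ys].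
    by rewrite subrr normr0 mulr0 addr_ge0// sumr_ge0.
  by rewrite distrC; apply: W; rewrite ?mem_head// inE ys orbT.
rewrite inE path_variation_cons /= => /orP[/eqP -> _|ys _].
  have := path_variation_ge_detour yz => H.
  have := ler_distD (f x) (f a) (f z); have := ler_distD (f (last x s)) (f a) (f z).
  have := distrC (f a) (f x); have := distrC (f x) (f z).
  by have := distrC (f a) (f (last x s)); lra.
have := IH x y z ys yz.
by have := ler_distD (f a) (f (last x s)) (f x); have := distrC (f x) (f a); lra.
Qed.

End Variation.

Lemma itv_partition_through (R : realType) (l : seq R) :
  all (fun x => 0 <= x <= 1) l ->
  exists2 s, itv_partition 0 1 s & {subset l <= 0 :: s}.
Proof.
move=> l01; pose s := sort <=%O (undup [seq x <- l | 0 < x < 1]).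
have ms x : (x \in s) = (0 < x < 1) && (x \in l).
  by rewrite mem_sort mem_undup mem_filter.
exists (rcons s 1).
  split; last by rewrite last_rcons.
  rewrite rcons_path path_min_sorted ?sort_lt_sorted ?undup_uniq//=.
    have := mem_last 0 s; rewrite inE => /orP[/eqP ->|]; first exact: ltr01.
    by rewrite ms => /andP[/andP[]].
  by apply/allP => x; rewrite ms => /andP[/andP[]].
move=> x xl; have /andP[x0 x1] := allP l01 _ xl.
rewrite inE mem_rcons inE ms xl andbT.
have [->//|xn0] := eqVneq x 0.
have [->//|xn1] := eqVneq x 1.
by rewrite !lt_neqAle x0 x1 xn1 eq_sym xn0.
Qed.

(** * Mean projected length in the plane *)

Section Crofton.
Variable R : realType.

(** The sum does not change when [t] is shifted by [h], because [|cos|] has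
period [pi = n h]. One can therefore assume that [pi / 2 < t <= pi / 2 + h];
then all the cosines are nonpositive, and the sum is a Dirichlet kernel. *)
Lemma sum_norm_cos_le (n : nat) (t : R) (h := pi / n%:R : R) :
  (0 < n)%N -> t <= pi / 2 ->
  sin (h / 2) * (\sum_(j < n) `|cos (t + j%:R * h)|) <= 1.
Proof.
move=> n0 t2.
have nR : (0:R) < n%:R by rewrite ltr0n.
have p0 := pi_gt0 R.
have h0 : 0 < h by rewrite divr_gt0.
have nh : n%:R * h = pi by rewrite /h mulrC divfK// gt_eqF.
(* [s] is the least number of steps that moves [t] beyond [pi / 2]. *)
pose s := (Num.truncn ((pi / 2 - t) / h)).+1.
have /truncn_itv/= /andP[s1 s2] : 0 <= (pi / 2 - t) / h.
  by rewrite divr_ge0 ?subr_ge0// ltW.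
rewrite ler_pdivlMr// in s1; rewrite ltr_pdivrMr// in s2.
pose b := t + s%:R * h.
have b1 : pi / 2 < b by rewrite /b /s; lra.
have b2 : b <= pi / 2 + h by rewrite /b /s -natr1; lra.
have -> : \sum_(j < n) `|cos (t + j%:R * h)| = \sum_(j < n) `|cos (b + j%:R * h)|.
  rewrite -(@sum_periodic_shift R n (fun j => `|cos (t + j%:R * h)|) s).
    by apply: eq_bigr => j _; rewrite /b natrD mulrDl [X in t + X]addrC addrA.
  by move=> j; rewrite natrD mulrDl nh addrA cosDpi normrN.
have -> : \sum_(j < n) `|cos (b + j%:R * h)| = - \sum_(j < n) cos (b + j%:R * h).
  rewrite -sumrN; apply: eq_bigr => j _; rewrite ler0_norm//.
  have j0 : 0 <= j%:R * h by rewrite mulr_ge0// ltW.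
  have jn : j.+1%:R * h <= pi by rewrite -nh ler_wpM2r ?ler_nat// ltW.
  rewrite -natr1 mulrDl mul1r in jn.
  rewrite -(subrK pi (b + _)) cosDpi oppr_le0 cos_ge0_pihalf//; lra.
have := sum_cos_arith b h n; rewrite nh.
have -> : b + pi - h / 2 = b - h / 2 + pi by ring.
rewrite sinDpi => e.
by have := sin_le1 (b - h / 2); lra.
Qed.

Lemma polar_coordinates (x y : R) (r := Num.sqrt (x ^+ 2 + y ^+ 2)) :
  exists2 phi, 0 <= phi & x = r * cos phi /\ y = r * sin phi.
Proof.
have rr : r ^+ 2 = x ^+ 2 + y ^+ 2 by rewrite sqr_sqrtr// addr_ge0 ?sqr_ge0.
have r0 : 0 <= r by exact: sqrtr_ge0.
have [rz|rn0] := eqVneq r 0.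
  move: rr; rewrite rz expr0n/= => /esym/eqP.
  rewrite paddr_eq0 ?sqr_ge0// !sqrf_eq0 => /andP[/eqP -> /eqP ->].
  by exists 0; rewrite ?mul0r.
have rp : 0 < r by rewrite lt0r rn0.
have x2 : (x / r) ^+ 2 + (y / r) ^+ 2 = 1.
  by rewrite !exprMn -mulrDl -rr -exprMn divff ?expr1n.
have c1 : -1 <= x / r <= 1.
  rewrite -ler_norml -(@ler_pXn2r _ 2)// ?nnegrE// real_normK ?num_real//.
  by rewrite expr1n -x2 lerDl sqr_ge0.
have sE : sin (acos (x / r)) = `|y| / r.
  rewrite sin_acos// -x2 addrC addKr sqrtr_sqr normrM normfV.
  by rewrite (ger0_norm r0).
have [y0|y0] := leP 0 y.
  exists (acos (x / r)); first exact: acos_ge0.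
  by rewrite acosK ?in_itv// sE (ger0_norm y0) ![r * _]mulrC !divfK.
(* The turn by [2 pi] keeps the angle nonnegative. *)
exists (pi *+ 2 - acos (x / r)).
  by have := acos_lepi c1; have := pi_gt0 R; rewrite mulr2n; lra.
rewrite addrC cosD2pi sinD2pi cosN sinN acosK ?in_itv// sE (ltr0_norm y0).
by split; field.
Qed.

End Crofton.

(** * A discrete Cauchy-Crofton inequality *)

Section PlanarShadow.
Variables (R : realType) (d : nat).
Implicit Types (v : 'rV[R]_d.+2) (g : R -> 'rV[R]_d.+2).

Definition second_coord : 'I_d.+2 := lift ord0 ord0.

(** The scalar product with the unit vector of angle [t] in the plane of the
first two coordinates. *)
Definition shadow (t : R) v : R := v 0 ord0 * cos t + v 0 second_coord * sin t.

Lemma shadowB t v w : shadow t (v - w) = shadow t v - shadow t w.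
Proof. by rewrite /shadow !mxE; ring. Qed.

Lemma shadowDpi t v : shadow (t + pi) v = - shadow t v.
Proof. by rewrite /shadow cosDpi sinDpi; ring. Qed.

(** In polar coordinates the shadows of [v] are cosines in arithmetic
progression. *)
Lemma sum_norm_shadow_le (n : nat) v (h := pi / n%:R : R) : (0 < n)%N ->
  sin (h / 2) * (\sum_(j < n) `|shadow (h / 2 + j%:R * h) v|) <= enorm v.
Proof.
move=> n0; set x := v 0 ord0; set y := v 0 second_coord.
have [phi phi0 [xE yE]] := polar_coordinates x y.
set r := Num.sqrt _ in xE yE.
have r0 : 0 <= r by exact: sqrtr_ge0.
have rv : r <= enorm v.
  rewrite ler_sqrt; last by apply: sumr_ge0 => i _; exact: sqr_ge0.
  by rewrite !big_ord_recl/= addrA lerDl sumr_ge0// => i _; exact: sqr_ge0.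
have nR : (1:R) <= n%:R by rewrite ler1n.
have hpi : h <= pi by rewrite ler_pdivrMr ?ler_peMr ?pi_ge0// ltr0n.
have -> : \sum_(j < n) `|shadow (h / 2 + j%:R * h) v| =
    r * \sum_(j < n) `|cos (h / 2 - phi + j%:R * h)|.
  rewrite mulr_sumr; apply: eq_bigr => j _.
  rewrite /shadow -/x -/y xE yE addrAC cosB -[X in X * `|_|](ger0_norm r0) -normrM.
  by congr `|_|; ring.
rewrite mulrCA; apply: le_trans rv; rewrite ler_piMr//.
by apply: sum_norm_cos_le => //; lra.
Qed.

(** The [n] directions of the half circle are used for the variation of the
projections; the other [n] ones of the sum are their opposites, so that the
terms [j] and [n + j] together are a difference of two values of the same
projection. *)
Lemma polygon_length_shadow_ge g s (n : nat) (T : nat -> R) (h := pi / n%:R : R) :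
  (0 < n)%N -> g (last 0 s) = g 0 -> (forall i, T i \in 0 :: s) ->
  2 * sin (h / 2) * \sum_(i < n + n) shadow (h / 2 + i%:R * h) (g (T i)) <=
  polygon_length g 0 s.
Proof.
move=> n0 gl Ts.
have nR : (1:R) <= n%:R by rewrite ler1n.
have nR0 : (0:R) < n%:R by rewrite ltr0n.
have h0 : 0 < h by rewrite divr_gt0// pi_gt0.
have nh : n%:R * h = pi by rewrite /h mulrC divfK// gt_eqF.
have hpi : h <= pi by rewrite ler_pdivrMr ?ler_peMr ?pi_ge0// ltr0n.
have sh : 0 <= sin (h / 2) by rewrite sin_ge0_pi//; lra.
pose th (j : nat) := h / 2 + j%:R * h.
have V : sin (h / 2) * (\sum_(j < n) path_variation (fun t => shadow (th j) (g t)) 0 s) <=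
    polygon_length g 0 s.
  rewrite /path_variation exchange_big mulr_sumr; apply: ler_sum => e _.
  apply: le_trans (sum_norm_shadow_le (g e.1 - g e.2) n0).
  by rewrite ler_wpM2l//; apply: ler_sum => j _; rewrite shadowB.
apply: le_trans V.
rewrite [2 * _]mulrC -mulrA ler_wpM2l// big_split_ord /= -big_split/= mulr_sumr.
apply: ler_sum => j _.
have := path_variation_ge_twice (fun t => shadow (th j) (g t)) (Ts j) (Ts (n + j)%N).
rewrite gl subrr normr0 addr0; apply: le_trans; rewrite ler_wpM2l//.
apply: le_trans (ler_norm _).
have -> : h / 2 + (n + j)%:R * h = th j + pi by rewrite /th natrD mulrDl nh; ring.
by rewrite shadowDpi.
Qed.

Lemma curve_length_shadow_ge g (n : nat) (T : nat -> R) (h := pi / n%:R : R) :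
  (0 < n)%N -> g 0 = g 1 -> (forall i, 0 <= T i <= 1) ->
  ((2 * sin (h / 2) * \sum_(i < n + n) shadow (h / 2 + i%:R * h) (g (T i)))%:E <=
  curve_length g 0 1)%E.
Proof.
move=> n0 g01 T01.
pose l := [seq T i | i <- iota 0 (n + n)].
have l01 : all (fun x => 0 <= x <= 1) l by apply/allP => _ /mapP[i _ ->].
have [s ps ls] := itv_partition_through l01.
apply: (@le_trans _ _ (polygon_length g 0 s)%:E); last first.
  by apply: ereal_sup_ubound; exists s.
rewrite lee_fin; have [_ /eqP l1] := ps.
(* Only the first [n + n] times are in the list; [0] is a vertex of every
   partition, and serves as a default. *)
pose T' i := if (i < n + n)%N then T i else 0.
rewrite (eq_bigr (fun i : 'I_(n + n) => shadow (h / 2 + i%:R * h) (g (T' i)))).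
  apply: polygon_length_shadow_ge => //; first by rewrite l1.
  move=> i; rewrite /T'; case: ifPn => [i2n|_]; last exact: mem_head.
  by apply: ls; apply/mapP; exists i => //; rewrite mem_iota.
by move=> i _; rewrite /T' ltn_ord.
Qed.

End PlanarShadow.

(** * Comparison with an arc of a discrete circle *)

(** The left-hand side is the sum for the extremal configuration: [M] values
equal to [c 0], and two values equal to each of the following [c q]. As [c] is
nonincreasing, [x i] is at least the sum of [c r] and of the drops
[c p - c p.+1] over the levels [c p] that it reaches; summing over [i] counts
the superlevel sets. *)
Lemma layer_cake_sum_ge (R : realDomainType) (N M r : nat)
    (c : nat -> R) (x : 'I_N -> R) :
  (M + r.*2 = N)%N ->
  (forall q, (q < r)%N -> c q.+1 <= c q) ->
  (forall q, (q <= r)%N -> (M + q.*2 <= #|[set i | (c q <= x i)%R]%SET|)%N) ->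
  M%:R * c 0%N + 2 * (\sum_(q < r) c q.+1) <= \sum_i x i.
Proof.
move=> MN anti H.
have anti' p q : (p <= q)%N -> (q <= r)%N -> c q <= c p.
  move=> pq; rewrite -(subnKC pq); elim: (q - p)%N => [|e IH]; first by rewrite addn0.
  by rewrite addnS => le_r; apply: le_trans (anti _ le_r) (IH (ltnW le_r)).
pose D q := c q - c q.+1.
have P i q : (q <= r)%N -> c q <= x i ->
    c q + \sum_(p < q) D p * (c p <= x i)%R%:R <= x i.
  elim: q => [|q IH] qr cq; first by rewrite big_ord0 addr0.
  rewrite big_ord_recr /=; have [cx|xc] := leP (c q) (x i).
    by have := IH (ltnW qr) cx; rewrite mulr1 /D; lra.
  rewrite big1 ?mulr0 ?addr0// => p _.
  rewrite [_ <= _](_ : _ = false) ?mulr0//; apply/negbTE; rewrite -ltNge.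
  by apply: lt_le_trans xc (anti' _ _ _ _); exact: ltnW.
have xr i : c r <= x i.
  have := H r (leqnn r); rewrite MN => le_N.
  have /eqP : [set i | (c r <= x i)%R]%SET == [set: 'I_N]%SET.
    by rewrite eqEcard finset.subsetT/= cardsT card_ord.
  by move/setP => /(_ i); rewrite !inE.
apply: (@le_trans _ _ (\sum_i (c r + \sum_(p < r) D p * (c p <= x i)%R%:R))); last first.
  by apply: ler_sum => i _; apply: P.
rewrite big_split/= sumr_const card_ord exchange_big /=.
apply: (@le_trans _ _ (N%:R * c r + \sum_(p < r) D p * (M + p.*2)%:R)).
  rewrite -MN le_eqVlt; apply/orP; left; apply/eqP.
  elim: r {H anti anti' P xr MN} => [|q IH].
    by rewrite !big_ord0 addn0 mulr0.
  rewrite !big_ord_recr /= mulrDr addrA IH /D doubleS !addnS -!natr1; ring.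
rewrite -[c r *+ N]mulr_natl lerD2l; apply: ler_sum => p _.
rewrite -mulr_sumr ler_wpM2l ?subr_ge0 ?anti//.
rewrite -natr_sum ler_nat (leq_trans (H p (ltnW (ltn_ord p))))//.
by rewrite -sum1dep_card big_mkcond/= leq_sum// => i _; case: ifP.
Qed.

Section CyclicGrowth.
Variables (N : nat) (J : {set 'I_N}).

Definition forward_reach (r : nat) : {set 'I_N} :=
  [set i : 'I_N | [exists j in J, [exists l : 'I_r.+1, ((j + l) %% N)%N == i]]]%SET.

Lemma forward_reach_S r i : i \in forward_reach r ->
  (i \in forward_reach r.+1) && (ordS i \in forward_reach r.+1).
Proof.
rewrite !inE => /existsP[j /andP[jJ /existsP[l /eqP e]]].
apply/andP; split; apply/existsP; exists j; rewrite jJ /=; apply/existsP.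
  by exists (widen_ord (leqnSn _) l); rewrite /= e.
exists (lift ord0 l); apply/eqP.
by rewrite /= -e -[in RHS]addn1 modnDml /bump leq0n addnA addnAC.
Qed.

Lemma ordS_closed_setT (A : {set 'I_N}) i0 : i0 \in A ->
  (forall i, i \in A -> ordS i \in A) -> A = [set: 'I_N]%SET.
Proof.
move=> i0A HA; apply/setP => i; rewrite inE.
have it m : iter m (@ordS N) i0 \in A by elim: m => //= m /HA.
have itE m : val (iter m (@ordS N) i0) = ((i0 + m) %% N)%N.
  elim: m => [|m /= ->]; first by rewrite addn0 modn_small.
  by rewrite -addn1 modnDml addn1 addnS.
suff e : iter (i + (N - i0)) (@ordS N) i0 = i by rewrite -e it.
apply: val_inj; rewrite itE addnCA subnKC ?(ltnW (ltn_ord i0))//.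
by rewrite modnDr modn_small.
Qed.

(** Until everything is reached, each step adds at least one point, because a
nonempty subset of a cycle that is closed under the successor is everything. *)
Lemma card_forward_reach r : (0 < #|J|)%N ->
  (minn N (#|J| + r) <= #|forward_reach r|)%N.
Proof.
move=> J0.
have sub0 : J \subset forward_reach 0.
  apply/fintype.subsetP => j jJ; rewrite inE; apply/existsP; exists j; rewrite jJ.
  by apply/existsP; exists ord0; rewrite /= addn0 modn_small.
have subS q : forward_reach q \subset forward_reach q.+1.
  by apply/fintype.subsetP => i /forward_reach_S /andP[].
elim: r => [|r IH].
  by rewrite addn0 (leq_trans (geq_minr _ _))// subset_leq_card.
have [E|nE] := eqVneq (forward_reach r) [set: 'I_N]%SET.
  have : forward_reach r.+1 = [set: 'I_N]%SET.
    by apply/eqP; rewrite -finset.subTset -E.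
  by move=> ->; rewrite cardsT card_ord geq_minl.
suff lt : (#|forward_reach r| < #|forward_reach r.+1|)%N by lia.
apply: proper_card; rewrite finset.properEneq subS andbT; apply: contra nE => /eqP E.
have [j jJ] := card_gt0P J0.
apply/eqP/(@ordS_closed_setT _ j).
  have : j \in forward_reach 0 by exact: (fintype.subsetP sub0).
  elim: (r) => // q IHq; first by move/IHq => /(fintype.subsetP (subS q)).
by move=> i; rewrite {2}E => /forward_reach_S /andP[].
Qed.

(** The two-sided neighborhood of radius [r] is a rotation by [r] of the set
of points reached in [2 r] forward steps. *)
Lemma card_cyclic_neighborhood r : (0 < #|J|)%N ->
  (minn N (#|J| + r.*2) <=
   #|[set i : 'I_N | [exists j in J, [exists l : 'I_r.*2.+1,
       (j + l == i + r %[mod N])%N]]]%SET|)%N.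
Proof.
move=> J0; apply: (leq_trans (card_forward_reach r.*2 J0)).
have f_inj : injective (iter r (@ordS N)).
  by elim: r => //= q IH i j /ordS_inj/IH.
have itE q i : iter q (@ordS N) i = ((i + q) %% N)%N :> nat.
  elim: q => [|q /= ->]; first by rewrite addn0 modn_small.
  by rewrite -addn1 modnDml addn1 addnS.
rewrite -[leqLHS](on_card_preimset (onW_bij _ (injF_bij f_inj))).
apply: subset_leq_card; apply/fintype.subsetP => i; rewrite !inE.
move=> /existsP[j /andP[jJ /existsP[l /eqP e]]].
apply/existsP; exists j; rewrite jJ; apply/existsP; exists l.
by apply/eqP; rewrite e itE.
Qed.

End CyclicGrowth.

(** * Measure and number of cells met *)

Section HitCells.
Variables (R : realType) (N : nat) (h : R) (S : set R).

Definition hit_cells : {set 'I_N} :=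
  [set j : 'I_N | `[< exists2 s, S s & j%:R * h <= s < j.+1%:R * h >]]%SET.

(** The cells met by [S] cover it, and the outer measure is monotone and
subadditive. *)
Lemma card_hit_cells (M : nat) : 0 < h -> S `<=` `[0, N%:R * h[ ->
  completed_lebesgue_measure S = (M%:R * h)%:E -> (M <= #|hit_cells|)%N.
Proof.
move=> h0 SN mS.
pose cell (j : nat) : set R := `[j%:R * h, j.+1%:R * h[%classic.
pose nu := (@wlength R idfun)^*%mu.
have nu_cell j : nu (cell j) = h%:E.
  have -> : nu (cell j) = lebesgue_measure (cell j) by [].
  rewrite lebesgue_measure_itv/= lte_fin ltr_pM2r// ltr_nat leqnn.
  by rewrite -EFinB -mulrBl -natr1 addrC addKr mul1r.
have nu_cells (r : seq 'I_N) :
    (nu (\big[setU/set0]_(j <- r) cell j) <= ((size r)%:R * h)%:E)%E.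
  elim: r => [|j r IH]; first by rewrite big_nil /nu outer_measure0 mul0r.
  rewrite big_cons; apply: (le_trans (outer_measureU2 _ _ _)).
  by rewrite /= -natr1 mulrDl mul1r addrC EFinD leeD// -/nu nu_cell.
have cover : S `<=` \big[setU/set0]_(j <- enum hit_cells) cell j.
  move=> s Ss; rewrite -bigcup_seq.
  have := SN _ Ss; rewrite set_itvcoE => /andP[s0 sN].
  have /truncn_itv/= : 0 <= s / h by rewrite divr_ge0// ltW.
  rewrite ler_pdivlMr// ltr_pdivrMr// => /andP[s1 s2].
  have jN : (Num.truncn (s / h) < N)%N.
    by rewrite -(ltr_nat R) -(ltr_pM2r h0) (le_lt_trans s1).
  exists (Ordinal jN); last by rewrite /cell set_itvcoE s1 s2.
  rewrite /= mem_enum inE; apply/asboolP; exists s => //=.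
  by rewrite s1 s2.
have : ((M%:R * h)%:E <= ((size (enum hit_cells))%:R * h)%:E)%E.
  by rewrite -mS; exact: le_trans (le_outer_measure nu _ _ cover) (nu_cells _).
by rewrite lee_fin ler_pM2r// ler_nat -cardE.
Qed.

End HitCells.

(** * The unit circle *)

Section Circle.
Variables (R : realType) (d : nat).

Definition circle_param (t : R) : 'rV[R]_d.+2 :=
  \row_i if i == ord0 then cos t else if i == second_coord d then sin t else 0.

Lemma circle_coord t :
  circle_param t 0 ord0 = cos t /\ circle_param t 0 (second_coord d) = sin t.
Proof. by rewrite !mxE. Qed.

Lemma shadow_circle t s : shadow t (circle_param s) = cos (s - t).
Proof. by rewrite /shadow; have [-> ->] := circle_coord s; rewrite cosB. Qed.

Lemma enorm_circle_chord s t :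
  enorm (circle_param s - circle_param t) = 2 * `|sin ((s - t) / 2)|.
Proof.
apply/eqP; rewrite -(@eqrXn2 _ 2) ?mulr_ge0 ?enorm_ge0//; apply/eqP.
rewrite exprMn real_normK ?num_real// sqr_enorm !big_ord_recl big1 => [|i _].
  rewrite !mxE/= (_ : 2 ^+ 2 = 2 * 2)// -mulrA sin_half_sqr cosB.
  have := cos2Dsin2 s; have := cos2Dsin2 t; lra.
by rewrite !mxE/= subrr expr0n.
Qed.

(** For the regular polygonal lines inscribed in the circle. *)
Lemma polygon_length_traject (g : R -> 'rV[R]_d.+2) (e l : R) (n : nat) a :
  (forall x, enorm (g (x + e) - g x) = l) ->
  polygon_length g a (traject (fun x => x + e) (a + e) n) = n%:R * l.
Proof.
move=> H; elim: n a => [|n IH] a; first by rewrite polygon_length_nil mul0r.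
by rewrite polygon_length_cons H IH -natr1 mulrDl mul1r addrC.
Qed.

(** Chords are shorter than arcs, and inscribed polygonal lines with [n.+1]
equal edges have length [2 (n.+1) sin ((b - a) / (2 (n.+1)))]. *)
Lemma circle_arc_length a b : a <= b ->
  curve_length circle_param a b = (b - a)%:E.
Proof.
move=> ab; apply/eqP; rewrite eq_le; apply/andP; split.
  apply: (@curve_length_le _ _ _ id) => x y xy.
  rewrite enorm_circle_chord; have := norm_sin_le ((y - x) / 2).
  by rewrite (ger0_norm (x := _ / 2)) ?divr_ge0 ?subr_ge0//; lra.
have [e|nab] := eqVneq a b; last have {nab}ltab : a < b by rewrite lt_neqAle nab.
  rewrite e subrr; apply: ereal_sup_ubound; exists [::].
    by split => //=; exact: eqxx.
  by rewrite polygon_length_nil.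
pose u (n : nat) : R := 2 * (n.+1%:R * sin ((b - a) / 2 / n.+1%:R)).
have cu : u n @[n --> \oo] --> b - a.
  rewrite -[X in _ --> X](_ : 2 * ((b - a) / 2) = _); last by field.
  apply: cvgM; first exact: cvg_cst.
  by apply: cvg_mul_sin_div; rewrite divr_ge0// subr_ge0 ltW.
have cE : (u n)%:E @[n --> \oo] --> (b - a)%:E by apply: cvg_EFin; first exact: nearW.
rewrite -(cvg_lim (@ereal_hausdorff R) cE).
apply: lime_le; first by apply/cvg_ex; eexists; exact: cE.
apply: nearW => n.
pose e := (b - a) / n.+1%:R.
have e0 : 0 < e by rewrite divr_gt0 ?subr_gt0.
have ul : u n <= n.+1%:R * (2 * `|sin (e / 2)|).
  rewrite /u mulrCA ler_wpM2l// ler_wpM2l//.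
  by rewrite (_ : _ / n.+1%:R = e / 2) ?ler_norm// /e; field; rewrite gt_eqF.
apply: (@le_trans _ _ (n.+1%:R * (2 * `|sin (e / 2)|))%:E); first by rewrite lee_fin.
apply: ereal_sup_ubound; exists (traject (fun x => x + e) (a + e) n.+1).
  split.
    by rewrite -/(path _ _ _); elim: (n.+1) (a) => //= q IH x; rewrite ltrDl e0/=.
  rewrite last_traject.
  have it q : iter q (fun x => x + e) a = a + q%:R * e.
    by elim: q => [|q /= ->]; rewrite ?mul0r ?addr0// -natr1 mulrDl mul1r addrA.
  have n0 : n.+1%:R != 0 :> R by rewrite pnatr_eq0.
  by apply/eqP; rewrite it /e; field.
congr EFin; apply: polygon_length_traject => x.
by rewrite enorm_circle_chord addrC addKr.
Qed.

Lemma circle_periodic t : circle_param (t + pi * 2) = circle_param t.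
Proof.
by apply/rowP => i; rewrite !mxE -[pi * 2]mulr1 (cosD2pin _ 1) (sinD2pin _ 1).
Qed.

Definition circle : closed_curve R d.+2 :=
  @ClosedCurve R d.+2 (pi * 2) circle_param
    (mulr_gt0 (pi_gt0 R) (ltr0Sn R 1)) circle_periodic circle_arc_length.

End Circle.

(** * The lower bound *)

Section LowerBound.
Variables (R : realType) (d k : nat).
Hypothesis k0 : (0 < k)%N.

(** A point [s] of the cell [j] and the centre of the cell [i] are at angular
distance at most [(r + 1 / 2) h] when [i] and [j] are at most [r] cells apart.
The difference of [i] and [j] is encoded by [l - r], to stay within natural
numbers. *)
Lemma cos_cell_ge (N r l i j : nat) (h s : R) : N%:R * h = pi * 2 -> 0 <= h ->
  (l <= r.*2)%N -> (j + l = i + r %[mod N])%N ->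
  j%:R * h <= s < j.+1%:R * h -> r%:R * h + h / 2 <= pi ->
  cos (h / 2 + r%:R * h) <= cos (s - (h / 2 + i%:R * h)).
Proof.
move=> Nh h0 lr e /andP[s1 s2] rpi.
rewrite -natr1 mulrDl mul1r in s2.
have eR : (j%:R + l%:R - i%:R - r%:R) * h =
    pi * 2 * ((j + l) %/ N)%:R - pi * 2 * ((i + r) %/ N)%:R.
  have -> : j%:R + l%:R - i%:R - r%:R = (j + l)%:R - (i + r)%:R :> R.
    by rewrite !natrD; ring.
  rewrite {1}(divn_eq (j + l) N) {1}(divn_eq (i + r) N) e !natrD !natrM -Nh; ring.
rewrite -(cosD2pin (s - _) ((i + r) %/ N)).
(* [x] is the angle from the centre of the cell [i] to [s], up to full turns. *)
pose x := s - j%:R * h - h / 2 + (r%:R - l%:R) * h.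
have -> : s - (h / 2 + i%:R * h) + pi * 2 * ((i + r) %/ N)%:R =
    x + pi * 2 * ((j + l) %/ N)%:R.
  by rewrite /x; move: eR; rewrite !mulrBl !mulrDl; lra.
rewrite cosD2pin -(cos_norm x).
have l0 : 0 <= l%:R * h by rewrite mulr_ge0.
have lr2 : l%:R * h <= 2 * (r%:R * h).
  by rewrite mulrA ler_wpM2r// -natrM ler_nat mul2n.
apply: cos_le_anti => //; last by lra.
by rewrite ler_norml /x mulrBl; lra.
Qed.

(** The circle is divided into [2 k n] cells, and the directions point to
their centres. At least [2 n] cells meet [S]. For each direction, [best]
selects the cell whose chosen point of [S] has the largest projection; the
resulting values dominate the profile of an arc of [2 n] cells, whose sum is
a Dirichlet kernel. *)
Lemma curve_length_ge_discrete (g : R -> 'rV[R]_d.+2) (S : set R) (n : nat)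
    (h := pi / (k * n)%:R : R) :
  (0 < n)%N -> g 0 = g 1 -> S `<=` `[0, pi * 2[ ->
  completed_lebesgue_measure S = (pi * 2 / k%:R)%:E ->
  circle_param d @` S `<=` g @` `[0, 1] ->
  ((2 * n%:R * sin h + 2 * (sin (pi / k%:R - h) - sin h))%:E <= curve_length g 0 1)%E.
Proof.
move=> n0 g01 S2pi mS Sg.
set m := (k * n)%N; have m0 : (0 < m)%N by rewrite muln_gt0 k0.
have mR : (0:R) < m%:R by rewrite ltr0n.
have kR : (0:R) < k%:R by rewrite ltr0n.
have nR : (0:R) < n%:R by rewrite ltr0n.
have h0 : 0 < h by rewrite divr_gt0// pi_gt0.
have mh : m%:R * h = pi by rewrite /h mulrC divfK// gt_eqF.
pose N := (m + m)%N.
have Nh : N%:R * h = pi * 2 by rewrite natrD mulrDl mh; ring.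
pose J := @hit_cells R N h S.
have cJ : (n.*2 <= #|J|)%N.
  apply: card_hit_cells => //; first by rewrite Nh.
  rewrite mS; congr EFin; rewrite -addnn natrD /h /m natrM.
  by field; rewrite !gt_eqF.
have J0 : (0 < #|J|)%N by rewrite (leq_trans _ cJ)// double_gt0.
have [j0 j0J] := card_gt0P J0.
have hit (j : 'I_N) : {st : R * R | j \in J ->
    [/\ j%:R * h <= st.1 < j.+1%:R * h, 0 <= st.2 <= 1 &
        g st.2 = circle_param d st.1]}.
  apply: cid; case: (boolP (j \in J)) => [|_]; last by exists (0, 0).
  rewrite inE => /asboolP[s Ss js].
  have [t /= t01 gt] := Sg _ (ex_intro2 _ _ s Ss erefl).
  by exists (s, t) => _; split => //; move: t01; rewrite in_itv.
pose th (i : nat) : R := h / 2 + i%:R * h.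
pose F i (j : 'I_N) := shadow (th i) (g (sval (hit j)).2).
pose best i := [arg max_(j > j0 in J) F i j]%O.
have bestP i : best i \in J /\ forall j, j \in J -> F i j <= F i (best i).
  by rewrite /best; case: (@Order.TotalTheory.arg_maxP _ _ _ j0 (mem J) (F i) j0J).
pose T i := (sval (hit (best i))).2.
have T01 i : 0 <= T i <= 1.
  by have [bJ _] := bestP i; have [] := svalP (hit (best i)) bJ.
apply: le_trans (curve_length_shadow_ge m0 g01 T01); rewrite lee_fin -/h.
pose c (q : nat) := cos (h / 2 + q%:R * h).
have nm : (n <= m)%N by rewrite leq_pmull.
have thick q : (q <= m - n)%N -> q%:R * h + h / 2 <= pi.
  move=> qmn; have : q.+1%:R * h <= m%:R * h.
    by rewrite ler_wpM2r ?ler_nat// ?(ltW h0)//; lia.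
  by rewrite -natr1 mulrDl mul1r mh; lra.
have := @layer_cake_sum_ge R N n.*2 (m - n) c (fun i => shadow (th i) (g (T i))).
have MN : (n.*2 + (m - n).*2 = N)%N by rewrite /N; lia.
move=> /(_ MN) H.
have {H} : n.*2%:R * c 0%N + 2 * (\sum_(q < m - n) c q.+1) <=
    \sum_(i < N) shadow (th i) (g (T i)).
  apply: H => q qr.
    have := thick q.+1 qr; rewrite -natr1 mulrDl mul1r => hq.
    have q0 : 0 <= q%:R * h by rewrite mulr_ge0// ltW.
    by rewrite /c -[q.+1%:R]natr1 mulrDl mul1r; apply: cos_le_anti; lra.
  apply: leq_trans (subset_leq_card _).
    apply: (leq_trans _ (card_cyclic_neighborhood q J0)); lia.
  apply/fintype.subsetP => i; rewrite !inE.
  move=> /existsP[j /andP[jJ /existsP[l /eqP e]]].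
  have [_ bi] := bestP i; apply: le_trans (bi _ jJ).
  have [js _ gE] := svalP (hit j) jJ.
  rewrite /F gE shadow_circle; apply: (cos_cell_ge Nh (ltW h0) _ e js (thick _ qr)).
  by rewrite -ltnS.
have sh : 0 <= 2 * sin (h / 2).
  by rewrite mulr_ge0// sin_ge0_pi//; have := thick 0%N isT; lra.
move=> /(ler_wpM2l sh); apply: le_trans.
(* The [2 n] cells of the arc itself, and the two sides of its complement. *)
have head : 2 * sin (h / 2) * c 0%N = sin h.
  rewrite /c mul0r addr0 -[in RHS](_ : (h / 2) *+ 2 = h); last by rewrite mulr2n; lra.
  by rewrite sin_mulr2n mulr2n; ring.
have tail : 2 * sin (h / 2) * (\sum_(q < m - n) c q.+1) = sin (pi / k%:R - h) - sin h.
  have -> : \sum_(q < m - n) c q.+1 = \sum_(q < m - n) cos (h / 2 + h + q%:R * h).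
    by apply: eq_bigr => q _; rewrite /c -[q.+1%:R]natr1 mulrDl mul1r; congr cos; ring.
  rewrite sum_cos_arith.
  have -> : h / 2 + h - h / 2 = h by ring.
  congr (_ - _); have nh : n%:R * h = pi / k%:R.
    by rewrite /h /m natrM; field; rewrite !gt_eqF.
  have -> : h / 2 + h + (m - n)%:R * h - h / 2 = pi - (pi / k%:R - h).
    by rewrite natrB// mulrBl mh nh; ring.
  by rewrite sinB sinpi cospi mul0r sub0r mulN1r opprK.
rewrite -tail -head -mul2n natrM le_eqVlt; apply/orP; left; apply/eqP; ring.
Qed.

Lemma curve_length_ge_circle_part (g : R -> 'rV[R]_d.+2) (S : set R) :
  g 0 = g 1 -> S `<=` `[0, pi * 2[ ->
  completed_lebesgue_measure S = (pi * 2 / k%:R)%:E ->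
  circle_param d @` S `<=` g @` `[0, 1] ->
  ((2 * (pi / k%:R) + 2 * sin (pi / k%:R))%:E <= curve_length g 0 1)%E.
Proof.
move=> g01 S2pi mS Sg.
have kR : (0:R) < k%:R by rewrite ltr0n.
pose a : R := pi / k%:R.
pose h (n : nat) : R := a / n.+1%:R.
pose u n := 2 * (n.+1%:R * sin (h n)) + 2 * (sin (a - h n) - sin (h n)).
have ch : h @ \oo --> (0 : R) by exact: cvg_div_nat.
have cu : u n @[n --> \oo] --> 2 * a + 2 * (sin (a - 0) - sin 0).
  apply: cvgD; apply: cvgM; try exact: cvg_cst.
    by apply: cvg_mul_sin_div; rewrite divr_ge0 ?pi_ge0// ltW.
  have csin f l : f @ \oo --> l -> sin (f n) @[n --> \oo] --> sin (l : R).
    move=> fl.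
    exact: (@continuous_cvg _ _ _ _ _ f _ l (@continuous_sin R l) fl).
  by apply: cvgB; apply: csin => //; apply: cvgB => //; exact: cvg_cst.
rewrite subr0 sin0 subr0 in cu.
have cE : (u n)%:E @[n --> \oo] --> (2 * a + 2 * sin a)%:E.
  by apply: cvg_EFin; first exact: nearW.
rewrite -(cvg_lim (@ereal_hausdorff R) cE).
apply: lime_le; first by apply/cvg_ex; eexists; exact: cE.
apply: nearW => n.
have := curve_length_ge_discrete (ltn0Sn n) g01 S2pi mS Sg.
have -> : pi / (k * n.+1)%:R = h n by rewrite /h /a natrM; field; rewrite !gt_eqF.
by rewrite /u mulrA.
Qed.

(** The bound holds part by part, for every partition into equal measures. *)
Lemma beta_curve_circle_ge :
  ((k%:R^-1 + pi^-1 * sin (pi / k%:R))%:E <= beta_curve (circle R d) k)%E.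
Proof.
have kR : (0:R) < k%:R by rewrite ltr0n.
have p0 := pi_gt0 R.
apply: le_ereal_inf_tmp => _ [S [SU _ _ _ mS] <-].
rewrite /beta_partition.
have ws i : ((2 * (pi / k%:R) + 2 * sin (pi / k%:R))%:E <= w_subset (circle R d) (S i))%E.
  apply: le_ereal_inf_tmp => _ [g [[_ g01] Sg] <-].
  apply: (curve_length_ge_circle_part g01 _ (mS i) Sg).
  move: SU => /= <- x Sx; by exists i.
apply: (@le_trans _ _ ((k%:R^-1)%:E *
    (\sum_(i < k) (2 * (pi / k%:R) + 2 * sin (pi / k%:R))%:E) * ((pi * 2)^-1)%:E)%E).
  rewrite sumEFin -!EFinM lee_fin sumr_const card_ord -[(_ + _) *+ k]mulr_natl.
  rewrite le_eqVlt; apply/orP; left; apply/eqP.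
  have gen (p z : R) : 0 < p -> k%:R^-1 + p^-1 * z =
      k%:R^-1 * (k%:R * (2 * (p / k%:R) + 2 * z)) * (p * 2)^-1.
    by move=> pp; field; rewrite !gt_eqF.
  exact: gen.
apply: lee_wpmul2r; first by rewrite lee_fin invr_ge0 ltW// mulr_gt0.
apply: lee_wpmul2l; first by rewrite lee_fin invr_ge0 ltW.
by apply: lee_sum => i _; exact: ws.
Qed.

End LowerBound.

(** * The exact value *)

Theorem theorem1 (R : realType) (k d : nat) (hk : (1 <= k)%N) (hd : (2 <= d)%N) :
  beta R d k = (k%:R^-1 + pi^-1 * sin (pi / k%:R))%:E.
Proof.
case: d hd => [|[|d]] // _.
apply/eqP; rewrite eq_le; apply/andP; split.
  by apply: ge_ereal_sup => _ [C _ <-]; exact: beta_curve_le.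
apply: (le_trans (@beta_curve_circle_ge R d k hk)).
by apply: ereal_sup_ubound; exists (circle R d).
Qed.
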